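(* Let $q>0$, and let $\alpha_1\ge\alpha_2\ge\dots\ge 0$, $\beta_1\ge\beta_2\ge\dots\ge 0$ be real numbers with $\sum_i\alpha_i+\sum_j\beta_j=1$ (i.e. $\gamma=0$). Let $\chi=\chi^{\alpha,\beta,0}$ be the corresponding trace on $\mathcal{H}_\infty(q)$, let $\mathcal{X}$ be the infinite tensor product Hilbert space with distinguished vector $\Xi$, and let $A\mapsto A^{(l)}$, $A\mapsto A^{(r)}$ be the commuting representations of $\mathcal{H}_\infty(q)$ in $\mathcal{X}$ determined by $\sigma_j\mapsto R^{\mathrm{left}}_{j(j+1)}$ and $\sigma_j\mapsto R^{\mathrm{right}}_{j(j+1)}$ (all defined in the context). Then: (a) For any $A\in\mathcal{H}_\infty(q)$, $$\langle A^{(l)}\Xi,\Xi\rangle_{\mathcal{X}}=\chi^{\alpha,\beta,0}(A).$$ (b) The representation $A\otimes B\mapsto A^{(l)}B^{(r)}$ of $\mathcal{H}_\infty(q)\otimes\mathcal{H}_\infty(q)$ in the cyclic span of $\Xi$ (the closed linear span of all vectors $A^{(l)}B^{(r)}\Xi$) is equivalent to the representation $\tau_\chi$ of $\mathcal{H}_\infty(q)\otimes\mathcal{H}_\infty(q)$ in $\overline{\mathcal{H}_\infty(q)}_\chi$.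
   Context: **The algebra.** $\mathcal{H}_\infty(q)$ is the unital associative $\mathbb{C}$-algebra with generators $\sigma_1,\sigma_2,\dots$ and relations $\sigma_m^2=(q-1)\sigma_m+q$; $\sigma_m\sigma_{m+1}\sigma_m=\sigma_{m+1}\sigma_m\sigma_{m+1}$; $\sigma_m\sigma_l=\sigma_l\sigma_m$ for $|m-l|>1$. It carries the antilinear anti-automorphism (involution) $A\mapsto A^\star$ with $\sigma_m^\star=\sigma_m$ and the linear anti-automorphism (transposition) $A\mapsto A^t$ with $\sigma_m^t=\sigma_m$. **Traces.** A trace on a $*$-algebra $\mathcal{A}$ is a linear functional $\chi$ with $\chi(AB)=\chi(BA)$, $\chi(A^\star)=\overline{\chi(A)}$, $\chi(A^\star A)\ge0$. For $1\le\lambda\le\mu$ put $\zeta_{\lambda,\mu}=\sigma_{\mu-1}\sigma_{\mu-2}\cdots\sigma_\lambda$ (with $\zeta_{\lambda,\lambda}=1$), and $\zeta_m=\zeta_{1,m}$. For a partition $\nu_1\ge\dots\ge\nu_r>0$ put $\lambda_0=0$, $\lambda_j=\nu_1+\dots+\nu_j$, and $\zeta_\nu=\prod_{j=1}^r\zeta_{\lambda_{j-1}+1,\lambda_j}$ (the factors commute). A trace on $\mathcal{H}_\infty(q)$ is determined by its values on the elements $\zeta_\nu$. The trace $\chi^{\alpha,\beta,0}$ (which exists by a known theorem of Vershik and Kerov) is the trace such that $\chi(\zeta_\nu)=\prod_j\chi(\zeta_{\nu_j})$ and $$\chi^{\alpha,\beta,0}(\zeta_m)=\frac1{q-1}\sum_{\mu_1,\mu_2,\dots\ge0,\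 \sum_k k\mu_k=m}\ \prod_{k\ge1}\frac{(q^k-1)^{\mu_k}}{k^{\mu_k}\mu_k!}\prod_{k\ge2}p_k(\alpha,\beta)^{\mu_k},\qquad p_k(\alpha,\beta)=\sum_i\alpha_i^k+(-1)^{k+1}\sum_i\beta_i^k,$$ where for $q=1$ the right-hand side is understood by removing the singularity (limit $q\to1$). **The representation $\tau_\chi$.** $\overline{\mathcal{H}_\infty(q)}_\chi$ is the Hilbert space associated with the inner product $\langle A,B\rangle_\chi=\chi(B^\star A)$ on $\mathcal{H}_\infty(q)$ (quotient by null vectors and complete). The operators of left and right multiplication are bounded in it, and $\tau_\chi(A\otimes B)X=AXB^t$ (right multiplication is turned into a representation of $\mathcal{H}_\infty(q)$ by means of the transposition). **The matrix $R$.** Let $V$ be a Hilbert space with orthonormal basis $v_j$, $j\in\mathbb{Z}\setminus0$. Let $e_{\alpha\beta}$ be the matrix units in the first copy of $V$, $e_{\alpha\beta}v_i=v_\beta$ if $i=\alpha$ and $0$ otherwise; let $f_{\alpha\beta}$ be the same matrix units in the second copy of $V$. Define the operator in $V\otimes V$ (indices range over nonzero integers) $$R=-\sum_{i<0}e_{ii}\otimes f_{ii}+q\sum_{i>0}e_{ii}\otimes f_{ii}-\sqrt q\sum_{i\ne j}e_{ji}\otimes f_{ij}+(q-1)\sum_{i<j}e_{ii}\otimes f_{jj}.$$ **The space $\mathcal{X}$.** Let $W$ be a copy of $V$ with the corresponding basis $w_j$. Put $$\xi=\sum_{j>0}\sqrt{\beta_j}\,v_{-j}\otimes w_{-j}+\sum_{j>0}\sqrt{\alpha_j}\,v_j\otimes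 w_j\in V\otimes W,$$ a unit vector. $\mathcal{X}=(V\otimes W,\xi)\otimes(V\otimes W,\xi)\otimes\cdots$ is the infinite tensor product of Hilbert spaces with distinguished vectors $\xi$, and $\Xi=\xi\otimes\xi\otimes\cdots\in\mathcal{X}$. The operator $R^{\mathrm{left}}_{j(j+1)}$ acts as $R$ on the tensor product of the $j$-th and $(j+1)$-th copies of $V$ and as the identity on all other factors $V$ and on all factors $W$; $R^{\mathrm{right}}_{j(j+1)}$ acts as $R$ (with $w_i$ in place of $v_i$) on the $j$-th and $(j+1)$-th copies of $W$ and as the identity on all other factors. *)

(* Defs.v *)
From HB Require Import structures.
From mathcomp Require Import all_boot all_order all_algebra.
From mathcomp Require Import generic_quotient sesquilinear complex.
From mathcomp Require Import all_classical all_reals all_analysis.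

Set Implicit Arguments.
Unset Strict Implicit.
Unset Printing Implicit Defensive.

Import Order.TTheory GRing.Theory Num.Theory.
Import numFieldNormedType.Exports.

Local Open Scope classical_set_scope.
Local Open Scope quotient_scope.
Local Open Scope ring_scope.
Local Open Scope complex_scope.

(* Generators are numbered from 0: [HGen i] stands for sigma_(i+1). *)
Inductive hterm (C : Type) : Type :=
| HGen of nat
| HConst of C
| HAdd of hterm C & hterm C
| HMul of hterm C & hterm C.
Arguments HGen {C} _.

(* The least congruence on formal expressions whose quotient is a unital
   associative C-algebra satisfying the Hecke relations; scalar multiplication
   is multiplication by a (central) constant. *)
Inductive hcong (C : comNzRingType) (q : C) : hterm C -> hterm C -> Prop :=
| hc_refl t : hcong q t t
| hc_sym t u : hcong q t u -> hcong q u t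
| hc_trans t u v : hcong q t u -> hcong q u v -> hcong q t v
| hc_add t t' u u' :
    hcong q t t' -> hcong q u u' -> hcong q (HAdd t u) (HAdd t' u')
| hc_mul t t' u u' :
    hcong q t t' -> hcong q u u' -> hcong q (HMul t u) (HMul t' u')
| hc_addA t u v : hcong q (HAdd t (HAdd u v)) (HAdd (HAdd t u) v)
| hc_addC t u : hcong q (HAdd t u) (HAdd u t)
| hc_add0 t : hcong q (HAdd (HConst 0) t) t
| hc_addN t : hcong q (HAdd (HMul (HConst (-1)) t) t) (HConst 0)
| hc_mulA t u v : hcong q (HMul t (HMul u v)) (HMul (HMul t u) v)
| hc_mul1 t : hcong q (HMul (HConst 1) t) t
| hc_mulDl t u v : hcong q (HMul (HAdd t u) v) (HAdd (HMul t v) (HMul u v))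
| hc_mulDr t u v : hcong q (HMul t (HAdd u v)) (HAdd (HMul t u) (HMul t v))
| hc_constD a b : hcong q (HConst (a + b)) (HAdd (HConst a) (HConst b))
| hc_constM a b : hcong q (HConst (a * b)) (HMul (HConst a) (HConst b))
| hc_constC a t : hcong q (HMul (HConst a) t) (HMul t (HConst a))
| hc_quadratic m :
    hcong q (HMul (HGen m) (HGen m))
      (HAdd (HMul (HConst (q - 1)) (HGen m)) (HConst q))
| hc_braid m :
    hcong q (HMul (HMul (HGen m) (HGen m.+1)) (HGen m))
      (HMul (HMul (HGen m.+1) (HGen m)) (HGen m.+1))
| hc_far m l : (m.+1 < l)%N || (l.+1 < m)%N ->
    hcong q (HMul (HGen m) (HGen l)) (HMul (HGen l) (HGen m)).

HB.instance Definition _ (C : Type) := gen_eqMixin (hterm C).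
HB.instance Definition _ (C : Type) := gen_choiceMixin (hterm C).

Definition hcongb (C : comNzRingType) (q : C) (t u : hterm C) : bool :=
  `[< hcong q t u >].

Lemma hcongb_equiv (C : comNzRingType) (q : C) : equiv_class_of (hcongb q).
Proof.
split.
- by move=> t; apply/asboolP/hc_refl.
- by move=> t u; apply/asboolP/asboolP; exact: hc_sym.
- move=> u t v /asboolP tu /asboolP uv; apply/asboolP; exact: hc_trans tu uv.
Qed.

Canonical hcong_equiv (C : comNzRingType) (q : C) :=
  EquivRelPack (hcongb_equiv q).

Definition hecke_alg (C : comNzRingType) (q : C) := {eq_quot (hcong_equiv q)}.

Section HeckeAlgebra.
Variables (C : comNzRingType) (q : C).

Notation H := (hecke_alg q).

HB.instance Definition _ := Choice.on H.
HB.instance Definition _ := EqQuotient.on H.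

Definition hclass (t : hterm C) : H := \pi_H t.

Lemma hclassP t u : hclass t = hclass u <-> hcong q t u.
Proof. by split=> [/eqquotP/asboolP|?]; last apply/eqquotP/asboolP. Qed.

Lemma hclass_repr (x : H) : hclass (repr x) = x.
Proof. exact: reprK. Qed.

Lemma hecke_ind (P : H -> Prop) : (forall t, P (hclass t)) -> forall x, P x.
Proof. by move=> h x; rewrite -(hclass_repr x). Qed.

Definition hadd (x y : H) : H := hclass (HAdd (repr x) (repr y)).
Definition hmul (x y : H) : H := hclass (HMul (repr x) (repr y)).
Definition hopp (x : H) : H := hmul (hclass (HConst (-1))) x.
Definition hscale (a : C) (x : H) : H := hmul (hclass (HConst a)) x.

Lemma hrepr t : hcong q (repr (hclass t)) t.
Proof. by apply/hclassP; rewrite hclass_repr. Qed.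

Lemma haddE t u : hadd (hclass t) (hclass u) = hclass (HAdd t u).
Proof. by apply/hclassP/hc_add; exact: hrepr. Qed.

Lemma hmulE t u : hmul (hclass t) (hclass u) = hclass (HMul t u).
Proof. by apply/hclassP/hc_mul; exact: hrepr. Qed.

Lemma haddA : associative hadd.
Proof.
elim/hecke_ind=> t; elim/hecke_ind=> u; elim/hecke_ind=> v.
by rewrite !haddE; apply/hclassP/hc_addA.
Qed.

Lemma haddC : commutative hadd.
Proof.
elim/hecke_ind=> t; elim/hecke_ind=> u.
by rewrite !haddE; apply/hclassP/hc_addC.
Qed.

Lemma hadd0 : left_id (hclass (HConst 0)) hadd.
Proof. by elim/hecke_ind=> t; rewrite !haddE; apply/hclassP/hc_add0. Qed.

Lemma haddN : left_inverse (hclass (HConst 0)) hopp hadd.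
Proof.
by elim/hecke_ind=> t; rewrite /hopp hmulE haddE; apply/hclassP/hc_addN.
Qed.

HB.instance Definition _ := GRing.isZmodule.Build H haddA haddC hadd0 haddN.

Lemma hmulA : associative hmul.
Proof.
elim/hecke_ind=> t; elim/hecke_ind=> u; elim/hecke_ind=> v.
by rewrite !hmulE; apply/hclassP/hc_mulA.
Qed.

Lemma hconstC a x : hmul (hclass (HConst a)) x = hmul x (hclass (HConst a)).
Proof.
by elim/hecke_ind: x => t; rewrite !hmulE; apply/hclassP/hc_constC.
Qed.

Lemma hmul1l : left_id (hclass (HConst 1)) hmul.
Proof. by elim/hecke_ind=> t; rewrite !hmulE; apply/hclassP/hc_mul1. Qed.

Lemma hmul1r : right_id (hclass (HConst 1)) hmul.
Proof. by move=> x; rewrite -hconstC hmul1l. Qed.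

Lemma hmulDl : left_distributive hmul +%R.
Proof.
elim/hecke_ind=> t; elim/hecke_ind=> u; elim/hecke_ind=> v.
rewrite -[_ + _]/(hadd _ _) -[RHS]/(hadd _ _) !(haddE, hmulE).
exact/hclassP/hc_mulDl.
Qed.

Lemma hmulDr : right_distributive hmul +%R.
Proof.
elim/hecke_ind=> t; elim/hecke_ind=> u; elim/hecke_ind=> v.
rewrite -[_ + _]/(hadd _ _) -[RHS]/(hadd _ _) !(haddE, hmulE).
exact/hclassP/hc_mulDr.
Qed.

(* The character sigma_m |-> q, showing that the algebra is not trivial. *)
Fixpoint hindex (t : hterm C) : C :=
  match t with
  | HGen _ => q
  | HConst a => a
  | HAdd t u => hindex t + hindex u
  | HMul t u => hindex t * hindex u
  end.

Lemma hindex_cong t u : hcong q t u -> hindex t = hindex u.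
Proof.
elim=> //=.
- by move=> ? ? ? _ -> _ ->.
- by move=> ? ? ? ? _ -> _ ->.
- by move=> ? ? ? ? _ -> _ ->.
- by move=> *; rewrite addrA.
- by move=> *; rewrite addrC.
- by move=> *; rewrite add0r.
- by move=> *; rewrite mulN1r addNr.
- by move=> *; rewrite mulrA.
- by move=> *; rewrite mul1r.
- by move=> *; rewrite mulrDl.
- by move=> *; rewrite mulrDr.
- by move=> *; rewrite mulrC.
- by move=> *; rewrite mulrBl mul1r subrK.
Qed.

Lemma hone_neq0 : hclass (HConst 1) != 0.
Proof.
by apply/eqP => /hclassP/hindex_cong/= /eqP; rewrite oner_eq0.
Qed.

HB.instance Definition _ := GRing.Zmodule_isNzRing.Build H
  hmulA hmul1l hmul1r hmulDl hmulDr hone_neq0.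

Lemma hscaleA a b (x : H) : hscale a (hscale b x) = hscale (a * b) x.
Proof.
rewrite /hscale hmulA hmulE; congr (hmul _ x).
exact/hclassP/hc_sym/hc_constM.
Qed.

Lemma hscale1 : left_id 1 hscale.
Proof. exact: hmul1l. Qed.

Lemma hscaleDr : right_distributive hscale +%R.
Proof. by move=> a x y; exact: hmulDr. Qed.

Lemma hscaleDl (x : H) : {morph hscale^~ x : a b / a + b}.
Proof.
move=> a b; rewrite /hscale.
have -> : hclass (HConst (a + b)) = hclass (HConst a) + hclass (HConst b).
  by rewrite -[RHS]/(hadd _ _) haddE; apply/hclassP/hc_constD.
exact: hmulDl.
Qed.

HB.instance Definition _ := GRing.Zmodule_isLmodule.Build C H
  hscaleA hscale1 hscaleDr hscaleDl.

Lemma hscaleAl (a : C) (x y : H) : a *: (x * y) = a *: x * y.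
Proof. exact: hmulA. Qed.

HB.instance Definition _ := GRing.Lmodule_isLalgebra.Build C H hscaleAl.

Lemma hscaleAr (a : C) (x y : H) : a *: (x * y) = x * (a *: y).
Proof.
rewrite -[LHS]/(hmul _ (hmul _ _)) -[RHS]/(hmul _ (hmul _ _)).
by rewrite !hmulA hconstC.
Qed.

HB.instance Definition _ := GRing.Lalgebra_isAlgebra.Build C H hscaleAr.

Definition sigma (m : nat) : H := hclass (HGen m).

(* The anti-automorphism fixing the generators and acting by [f] on scalars. *)
Fixpoint hterm_anti (f : C -> C) (t : hterm C) : hterm C :=
  match t with
  | HGen m => HGen m
  | HConst a => HConst (f a)
  | HAdd t u => HAdd (hterm_anti f t) (hterm_anti f u)
  | HMul t u => HMul (hterm_anti f u) (hterm_anti f t)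
  end.

Definition hecke_anti (f : C -> C) (x : H) : H :=
  hclass (hterm_anti f (repr x)).

Lemma hterm_anti_cong (f : {rmorphism C -> C}) t u : f q = q ->
  hcong q t u -> hcong q (hterm_anti f t) (hterm_anti f u).
Proof.
move=> fq; elim=> /= *; rewrite ?(rmorphD, rmorphM, rmorph0, rmorph1, rmorphN, fq).
all: try by constructor.
- by apply: hc_trans; eassumption.
- by apply: hc_trans (hc_addN _ _); apply/hc_add/hc_refl/hc_sym/hc_constC.
- exact/hc_sym/hc_mulA.
- exact/hc_trans/hc_mul1/hc_sym/hc_constC.
- by rewrite mulrC; exact: hc_constM.
- exact/hc_sym/hc_constC.
- apply: hc_trans (hc_quadratic _ _) _.
  by apply/hc_add/hc_refl; exact: hc_constC.
- by apply: hc_trans (hc_mulA _ _ _ _) _; exact: hc_trans (hc_braid _ _) (hc_sym (hc_mulA _ _ _ _)).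
- by apply: hc_far; rewrite orbC.
Qed.

Lemma hecke_antiE (f : {rmorphism C -> C}) t : f q = q ->
  hecke_anti f (hclass t) = hclass (hterm_anti f t).
Proof. by move=> fq; apply/hclassP/hterm_anti_cong/hrepr. Qed.

End HeckeAlgebra.
Arguments sigma {C q} m.

Section StarTranspose.
Variables (R : realType) (q : R).

Notation H := (hecke_alg q%:C).

Definition hstar : H -> H := hecke_anti (@Num.conj R[i]).
Definition htransp : H -> H := hecke_anti (@id R[i]).

Lemma conj_real_complex (x : R) : Num.conj x%:C = x%:C.
Proof. by rewrite conj_Creal//; apply/complex_realP; exists x. Qed.

Lemma hstarE t : hstar (hclass q%:C t) = hclass q%:C (hterm_anti Num.conj t).
Proof. exact: (hecke_antiE _ (conj_real_complex q)). Qed.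

Lemma htranspE t : htransp (hclass q%:C t) = hclass q%:C (hterm_anti id t).
Proof. exact: (@hecke_antiE _ _ idfun). Qed.

Lemma hstar_sigma m : hstar (sigma m) = sigma m.
Proof. exact: hstarE. Qed.

Lemma hstarD A B : hstar (A + B) = hstar A + hstar B.
Proof.
elim/hecke_ind: A => t; elim/hecke_ind: B => u.
rewrite -[_ + _ in LHS]/(hadd _ _) -[RHS]/(hadd _ _) haddE.
by rewrite !hstarE haddE.
Qed.

Lemma hstarM A B : hstar (A * B) = hstar B * hstar A.
Proof.
elim/hecke_ind: A => t; elim/hecke_ind: B => u.
rewrite -[_ * _ in LHS]/(hmul _ _) -[RHS]/(hmul _ _) hmulE.
by rewrite !hstarE hmulE.
Qed.

Lemma hstarZ a A : hstar (a *: A) = Num.conj a *: hstar A.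
Proof.
elim/hecke_ind: A => t.
rewrite -[_ *: _ in LHS]/(hmul _ _) -[RHS]/(hmul _ _) hmulE.
rewrite !hstarE hmulE.
exact/hclassP/hc_sym/hc_constC.
Qed.

Lemma htransp_sigma m : htransp (sigma m) = sigma m.
Proof. exact: htranspE. Qed.

Lemma htranspD A B : htransp (A + B) = htransp A + htransp B.
Proof.
elim/hecke_ind: A => t; elim/hecke_ind: B => u.
rewrite -[_ + _ in LHS]/(hadd _ _) -[RHS]/(hadd _ _) haddE.
by rewrite !htranspE haddE.
Qed.

Lemma htranspM A B : htransp (A * B) = htransp B * htransp A.
Proof.
elim/hecke_ind: A => t; elim/hecke_ind: B => u.
rewrite -[_ * _ in LHS]/(hmul _ _) -[RHS]/(hmul _ _) hmulE.
by rewrite !htranspE hmulE.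
Qed.

Lemma htranspZ a A : htransp (a *: A) = a *: htransp A.
Proof.
elim/hecke_ind: A => t.
rewrite -[_ *: _ in LHS]/(hmul _ _) -[RHS]/(hmul _ _) hmulE.
rewrite !htranspE hmulE.
exact/hclassP/hc_sym/hc_constC.
Qed.

End StarTranspose.

Notation hecke q := (hecke_alg q%:C).

Record is_trace (R : realType) (q : R) (chi : {scalar hecke q}) : Prop := {
  trace_comm : forall A B, chi (A * B) = chi (B * A);
  trace_star : forall A, chi (hstar A) = Num.conj (chi A);
  trace_ge0 : forall A, 0 <= chi (hstar A * A) }.

(* [zeta l m] is the product sigma_(m-1) ... sigma_l in decreasing order; with
   strands numbered from 0 it is the element usually written
   zeta_(l+1,m+1). *)
Definition zeta (R : realType) (q : R) (l m : nat) : hecke q :=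
  \prod_(i <- rev (index_iota l m)) sigma i.

(* The j-th block occupies the strands sumn (take j nu), ...,
   (sumn (take j.+1 nu)).-1. *)
Definition zeta_part (R : realType) (q : R) (nu : seq nat) : hecke q :=
  \prod_(0 <= j < size nu) zeta q (sumn (take j nu)) (sumn (take j.+1 nu)).-1.

Definition is_partition (nu : seq nat) : bool :=
  sorted geq nu && (0%N \notin nu).

(* Super-symmetric power sum; the sequences are numbered from 0. *)
Definition psum (R : realType) (alpha beta : nat -> R) (k : nat) : R :=
  limn (series (fun i => alpha i ^+ k))
  + (-1) ^+ k.+1 * limn (series (fun i => beta i ^+ k)).

(* The sum over all (mu_1, mu_2, ...) with sum_k k mu_k = m: necessarily
   mu_k <= m for all k and mu_k = 0 for k > m; [mu i] stands for mu_(i+1). *)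
Definition zeta_formula (R : realType) (alpha beta : nat -> R) (m : nat)
    (q : R) : R :=
  (q - 1)^-1 *
  \sum_(mu : {ffun 'I_m -> 'I_m.+1} | (\sum_(i < m) i.+1 * mu i == m)%N)
     (\prod_(i < m) ((q ^+ i.+1 - 1) ^+ mu i
                      / (i.+1%:R ^+ mu i * (mu i)`!%:R)))
     * (\prod_(i < m | (2 <= i.+1)%N) psum alpha beta i.+1 ^+ mu i).

Definition zeta_value (R : realType) (alpha beta : nat -> R) (m : nat)
    (q : R) : R :=
  if q == 1 then lim (zeta_formula alpha beta m x @[x --> (1 : R)^'])
  else zeta_formula alpha beta m q.

(* chi = chi^{alpha,beta,0}; the element zeta_m is [zeta q 0 m.-1]. *)
Record is_vk_trace (R : realType) (q : R) (alpha beta : nat -> R)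
    (chi : {scalar hecke q}) : Prop := {
  vk_trace : is_trace chi;
  vk_zeta_part : forall nu, is_partition nu ->
    chi (zeta_part q nu) = \prod_(k <- nu) chi (zeta q 0 k.-1);
  vk_zeta : forall m, (1 <= m)%N ->
    chi (zeta q 0 m.-1) = (zeta_value alpha beta m q)%:C }.

HB.mixin Record CompleteNormedModule_isHilbert (R : realType) H
    of CompleteNormedModule R[i] H := {
  inner : {dot H for (@Num.conj R[i])};
  inner_norm : forall x : H, inner x x = `|x| ^+ 2 }.

#[short(type="hilbertType")]
HB.structure Definition Hilbert (R : realType) :=
  {H of CompleteNormedModule_isHilbert R H & CompleteNormedModule R[i] H}.

Definition lspan (K : nzRingType) (E : lmodType K) (A : set E) : set E :=
  [set x | exists n (c : 'I_n -> K) (a : 'I_n -> E),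
     (forall i, A (a i)) /\ x = \sum_(i < n) c i *: a i].

Definition closed_lspan (R : realType) (H : hilbertType R) (A : set H) : set H :=
  closure (lspan A).

Definition total_set (R : realType) (H : hilbertType R) (A : set H) : Prop :=
  closed_lspan A = setT.

Definition orthonormal_basis (R : realType) (H : hilbertType R) (I : eqType)
    (v : I -> H) : Prop :=
  (forall i j, inner (v i) (v j) = (i == j)%:R) /\ total_set (range v).

(* Hilbert tensor product of V and W, unique up to a unitary isomorphism. *)
Definition is_hilbert_tensor (R : realType) (V W U : hilbertType R)
    (tens : {bilinear V -> W -> U}) : Prop :=
  (forall x x' y y', inner (tens x y) (tens x' y') = inner x x' * inner y y')
  /\ total_set [set tens p.1 p.2 | p in [set: V * W]].

Definition eventually_eq (T : Type) (xi : T) (u : nat -> T) : Prop :=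
  exists N, forall n, (N <= n)%N -> u n = xi.

Definition put (T : Type) (u : nat -> T) (j : nat) (x : T) : nat -> T :=
  fun n => if n == j then x else u n.

(* The infinite tensor product (U, xi) (x) (U, xi) (x) ...: [tens u] is the
   elementary tensor u 0 (x) u 1 (x) ..., meaningful only when u n = xi for all
   large n. Unique up to a unitary isomorphism. *)
Record is_infinite_tensor (R : realType) (U X : hilbertType R) (xi : U)
    (tens : (nat -> U) -> X) : Prop := {
  itens_linear : forall u j (c : R[i]) x y, eventually_eq xi u ->
    tens (put u j (c *: x + y)) = c *: tens (put u j x) + tens (put u j y);
  itens_inner : forall u u' N,
    (forall n, (N <= n)%N -> u n = xi /\ u' n = xi) ->
    inner (tens u) (tens u') = \prod_(i < N) inner (u i) (u' i);
  itens_total : total_set [set tens u | u in eventually_eq xi] }.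

Record is_hilbert_rep (R : realType) (A : algType R[i]) (X : hilbertType R)
    (pi : A -> X -> X) : Prop := {
  rep_linear : forall a, linear (pi a);
  rep_bounded : forall a, continuous (pi a);
  rep_linear_l : forall (c : R[i]) a b x, pi (c *: a + b) x = c *: pi a x + pi b x;
  rep_one : forall x, pi 1 x = x;
  rep_mul : forall a b x, pi (a * b) x = pi a (pi b x) }.

(* A representation of A (x) B is given through the operators assigned to the
   elementary tensors a (x) b. The restriction of [pi] to the closed subspace S
   is unitarily equivalent to [tau] (S is then automatically invariant). *)
Definition equivalent_on (R : realType) (A B : Type) (X K : hilbertType R)
    (S : set X) (pi : A -> B -> X -> X) (tau : A -> B -> K -> K) : Prop :=
  exists T : {linear K -> X},
    [/\ forall x y, inner (T x) (T y) = inner x y,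
        range T = S &
        forall a b x, T (tau a b x) = pi a b (T x)].

(* (K, iota) is the separated completion of the algebra for <A, B>_chi. *)
Definition is_gns_space (R : realType) (q : R) (chi : {scalar hecke q})
    (K : hilbertType R) (iota : {linear hecke q -> K}) : Prop :=
  (forall A B, inner (iota A) (iota B) = chi (hstar B * A))
  /\ closure (range iota) = setT.

Record is_tau (R : realType) (q : R) (K : hilbertType R)
    (iota : {linear hecke q -> K}) (tau : hecke q -> hecke q -> K -> K) : Prop := {
  tau_linear : forall A B, linear (tau A B);
  tau_bounded : forall A B, continuous (tau A B);
  tau_iota : forall A B Z, tau A B (iota Z) = iota (A * Z * htransp B) }.

Definition znz := {j : int | j != 0}.
Definition zpos (n : nat) : znz := exist (fun j : int => j != 0) (Posz n.+1) isT.
Definition zneg (n : nat) : znz := exist (fun j : int => j != 0) (Negz n) isT.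

(* The image of v_a (x) v_c under R, with [t i j] in place of v_i (x) v_j:
   in each of the four sums of matrix units at most one term does not
   annihilate v_a (x) v_c, and e_(ji) (x) f_(ij) maps v_j (x) v_i to
   v_i (x) v_j. *)
Definition Rmat (R : realType) (q : R) (E : lmodType R[i]) (t : znz -> znz -> E)
    (a c : znz) : E :=
  - (if (a == c) && (val a < 0) then t a a else 0)
  + q%:C *: (if (a == c) && (0 < val a) then t a a else 0)
  - (Num.sqrt q)%:C *: (if a != c then t c a else 0)
  + (q - 1)%:C *: (if val a < val c then t a c else 0).

Section Space.
Variables (R : realType) (q : R) (V W U X : hilbertType R).
Variables (v : znz -> V) (w : znz -> W) (tens : {bilinear V -> W -> U}).

(* [zneg j] is the index -(j+1), [zpos j] the index j+1. *)
Definition xi_vector (alpha beta : nat -> R) : U :=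
  limn (series (fun j =>
    (Num.sqrt (beta j))%:C *: tens (v (zneg j)) (w (zneg j))))
  + limn (series (fun j =>
    (Num.sqrt (alpha j))%:C *: tens (v (zpos j)) (w (zpos j)))).

Variables (xi : U) (itens : (nat -> U) -> X).

Definition put2 (u : nat -> U) (j : nat) (x y : U) := put (put u j x) j.+1 y.

(* For a bounded operator T these formulas determine T, because the vectors
   involved are total in X. *)
Definition acts_as_Rleft (j : nat) (T : X -> X) : Prop :=
  forall u, eventually_eq xi u -> forall a c y y',
    T (itens (put2 u j (tens (v a) y) (tens (v c) y')))
    = Rmat q (fun a' c' => itens (put2 u j (tens (v a') y) (tens (v c') y'))) a c.

Definition acts_as_Rright (j : nat) (T : X -> X) : Prop :=
  forall u, eventually_eq xi u -> forall b d x x',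
    T (itens (put2 u j (tens x (w b)) (tens x' (w d))))
    = Rmat q (fun b' d' => itens (put2 u j (tens x (w b')) (tens x' (w d')))) b d.

End Space.

(* Main.v *)
Require Import Defs.
From HB Require Import structures.
From mathcomp Require Import all_boot all_order all_algebra.
From mathcomp Require Import generic_quotient sesquilinear complex.
From mathcomp Require Import all_classical all_reals all_analysis.
From mathcomp Require Import ring zify.

Set Implicit Arguments.
Unset Strict Implicit.
Unset Printing Implicit Defensive.

Import Order.TTheory GRing.Theory Num.Theory.
Import numFieldNormedType.Exports.

Local Open Scope classical_set_scope.
Local Open Scope ring_scope.
Local Open Scope complex_scope.

(** The vacuum expectation [A |-> <A Xi, Xi>] of the left action is shown to be
    a trace with the same values on the elements zeta as [chi]; since these
    values determine a trace, it equals [chi].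

    Trace property. The matrix [R] is real and symmetric, hence the generators
    act on both sides by self-adjoint operators ([acts_selfadjoint]). Left and
    right operators commute ([acts_commute]) and, [xi] being diagonal, they agree
    on the vacuum ([acts_vacuum]). Therefore a generator standing next to [Xi]
    can be replaced by its right version, moved through everything on the left,
    and moved to the other argument of the inner product ([vacuum_tracial]).

    Values on zeta. Generators in a word zeta act in increasing order of the
    indices and each one occurs once, so an exchange of different letters can
    never be undone, and only the diagonal entries of [R] contribute
    ([word_diag]): the expectation of a cycle of length [m] is the sum over
    [i_1 <= ... <= i_m] of the products of weights, with a factor [q], [-1] or
    [q - 1] for each pair of neighbours, and expectations of disjoint cycles
    multiply. The generating function of these sums is a product over the
    letters of the factors [(1 - a z) / (1 - q a z)] for the alphas and
    [(1 + q b z) / (1 + b z)] for the betas, that is the exponential of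
    [sum_k (q ^ k - 1) p_k z ^ k / k]. On the level of coefficients this is the
    Newton recursion, which is derived for finitely many letters
    ([chainF_newton]), passes to the limit ([newton_at_limit]), and
    characterizes the formula for [chi] ([zeta_value_newton]). Dividing the
    recursion by [q - 1] makes it hold at [q = 1] as well.

    Determination of a trace. Modulo commutators the Hecke algebra is spanned by
    words in which the generators occur at most once and in decreasing order
    ([trace_determined]), because [H_(n+1)] is the sum of [H_n] and
    [H_n s_n H_n]. Such a word is a product of cycles on consecutive blocks of
    strands, and conjugation by braids crossing two neighbouring blocks sorts the
    blocks ([trace_determined_sorted]).

    Equivalence. By the equality of [chi] with the vacuum expectation the map
    sending the class of [Z] to [Z Xi] (left action) is isometric; its extension
    to the completion is the required unitary, since the right action of [B] on
    the vacuum is the left action of the transpose of [B] ([r_vacuum]). *)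

(** * Generators of the Hecke algebra *)

Section HeckeWords.
Variables (C : fieldType) (q : C).
Local Notation H := (hecke_alg q).
Local Notation s := (@sigma C q).

Lemma hclassD t u : hclass q t + hclass q u = hclass q (HAdd t u).
Proof. exact: haddE. Qed.

Lemma hclassM t u : hclass q t * hclass q u = hclass q (HMul t u).
Proof. exact: hmulE. Qed.

Lemma hclass_const a : hclass q (HConst a) = a%:A.
Proof.
have -> : a%:A = hclass q (HMul (HConst a) (HConst 1)) by exact: hmulE.
by apply/hclassP/hc_sym; apply: hc_trans (hc_constC _ _ _) (hc_mul1 _ _).
Qed.

Lemma sigma_sq m : s m * s m = (q - 1) *: s m + q *: 1.
Proof.
rewrite -[s m in RHS]mul1r scalerAl -!hclass_const !hclassM hclassD.
exact/hclassP/hc_quadratic.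
Qed.

Lemma sigma_braid m : s m * s m.+1 * s m = s m.+1 * s m * s m.+1.
Proof. by rewrite /sigma !hclassM; apply/hclassP; apply: hc_braid. Qed.

Lemma sigma_far m l : (m.+1 < l)%N || (l.+1 < m)%N -> s m * s l = s l * s m.
Proof. by move=> h; rewrite /sigma !hclassM; apply/hclassP; apply: hc_far. Qed.

Lemma hecke_gen_ind (P : H -> Prop) :
  (forall m, P (s m)) -> (forall a, P a%:A) ->
  (forall x y, P x -> P y -> P (x + y)) ->
  (forall x y, P x -> P y -> P (x * y)) -> forall x, P x.
Proof.
move=> Ps Pa PD PM; elim/hecke_ind; elim=> [m|a|t Pt u Pu|t Pt u Pu].
- exact: Ps.
- by rewrite hclass_const.
- by rewrite -hclassD; apply: PD.
- by rewrite -hclassM; apply: PM.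
Qed.

(** The subalgebra generated by the selected [s m]; being inductive, it lends
    itself to commutation arguments. *)
Inductive gen_by (P : pred nat) : H -> Prop :=
| gen_sigma m : P m -> gen_by P (s m)
| gen_scal a : gen_by P a%:A
| gen_add x y : gen_by P x -> gen_by P y -> gen_by P (x + y)
| gen_mul x y : gen_by P x -> gen_by P y -> gen_by P (x * y).

Lemma gen_one P : gen_by P 1.
Proof. by rewrite -(scale1r 1); apply: gen_scal. Qed.

Lemma gen_sub (P Q : pred nat) x :
  (forall m, P m -> Q m) -> gen_by P x -> gen_by Q x.
Proof.
move=> PQ; elim=> [m /PQ Qm|a|y z _ Qy _ Qz|y z _ Qy _ Qz].
- exact: gen_sigma.
- exact: gen_scal.
- exact: gen_add.
- exact: gen_mul.
Qed.

Lemma gen_by0 x : gen_by (ltn^~ 0) x -> exists a, x = a%:A.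
Proof.
elim=> [//|a|y z _ [a ->] _ [b ->]|y z _ [a ->] _ [b ->]].
- by exists a.
- by exists (a + b); rewrite scalerDl.
- by exists (a * b); rewrite -scalerAl mul1r scalerA.
Qed.

Lemma gen_far_sigma (Q : pred nat) m y :
  (forall l, Q l -> (m.+1 < l)%N || (l.+1 < m)%N) ->
  gen_by Q y -> s m * y = y * s m.
Proof.
move=> far; elim=> [l /far/sigma_far//|a|x z _ IHx _ IHz|x z _ IHx _ IHz].
- by rewrite -scalerAl -scalerAr mulr1 mul1r.
- by rewrite mulrDl mulrDr IHx IHz.
- by rewrite mulrA IHx -mulrA IHz mulrA.
Qed.

Lemma gen_far (P Q : pred nat) x y :
  (forall m l, P m -> Q l -> (m.+1 < l)%N || (l.+1 < m)%N) ->
  gen_by P x -> gen_by Q y -> x * y = y * x.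
Proof.
move=> far Px Qy; elim: Px => [m Pm|a|z t _ IHz _ IHt|z t _ IHz _ IHt].
- by apply: gen_far_sigma Qy => l; exact: far.
- by rewrite -scalerAl -scalerAr mulr1 mul1r.
- by rewrite mulrDl mulrDr IHz IHt.
- by rewrite -mulrA IHt mulrA IHz mulrA.
Qed.

(** Writing [H_n] for the subalgebra generated by the first [n] generators,
    this is the sum of [H_n] and of the double coset [H_n s_n H_n]. *)
Inductive double_coset n : H -> Prop :=
| dc_base x : gen_by (ltn^~ n) x -> double_coset n x
| dc_gen x y : gen_by (ltn^~ n) x -> gen_by (ltn^~ n) y ->
    double_coset n (x * s n * y)
| dc_add x y : double_coset n x -> double_coset n y -> double_coset n (x + y).

Lemma double_coset_mull n z x :
  gen_by (ltn^~ n) z -> double_coset n x -> double_coset n (z * x).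
Proof.
move=> gz; elim=> [y gy|y t gy gt|y t _ IHy _ IHt].
- exact/dc_base/gen_mul.
- by rewrite !mulrA; apply: dc_gen => //; apply: gen_mul.
- by rewrite mulrDr; apply: dc_add.
Qed.

Lemma double_coset_mulr n z x :
  gen_by (ltn^~ n) z -> double_coset n x -> double_coset n (x * z).
Proof.
move=> gz; elim=> [y gy|y t gy gt|y t _ IHy _ IHt].
- exact/dc_base/gen_mul.
- by rewrite -!mulrA mulrA; apply: dc_gen => //; apply: gen_mul.
- by rewrite mulrDl; apply: dc_add.
Qed.

Lemma double_coset_sigma n : double_coset n (s n).
Proof. by rewrite -[s n]mulr1 -[s n]mul1r; apply: dc_gen; apply: gen_one. Qed.

Lemma double_cosetZ n a x : double_coset n x -> double_coset n (a *: x).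
Proof.
by rewrite -{2}[x]mul1r scalerAl; apply/double_coset_mull/gen_scal.
Qed.

(** The last generator never has to occur twice. Two occurrences enclose an
    element of the smaller subalgebra; by induction that element is a sum of
    terms containing at most one [s n], all other factors commute with
    [s n.+1], and the quadratic relation (no [s n] in between) or the braid
    relation (one [s n] in between) leaves a single [s n.+1]. *)
Lemma double_cosetP n x : gen_by (ltn^~ n.+1) x -> double_coset n x.
Proof.
elim: n x => [|n IHn] x.
  (* Only scalars can stand between two occurrences of [s 0]. *)
  elim=> [m|a|y z _ IHy _ IHz|y z _ IHy _ IHz].
  - rewrite /= ltnS leqn0 => /eqP ->.
    exact: double_coset_sigma.
  - exact/dc_base/gen_scal.
  - exact: dc_add.
  - elim: IHy => {y} [y gy|y t gy gt|y t _ IH1 _ IH2].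
    + exact: double_coset_mull.
    + have [a ->] := gen_by0 gt; rewrite -scalerAr mulr1 -scalerAl.
      rewrite -mulrA; apply: double_cosetZ; apply: double_coset_mull => //.
      elim: IHz => {z} [z gz|z t' gz gt'|z t' _ IH1 _ IH2].
      * by rewrite -[s 0]mul1r; apply: dc_gen => //; apply: gen_one.
      * have [b ->] := gen_by0 gz; rewrite mulrA; apply: double_coset_mulr => //.
        rewrite -scalerAl mul1r -scalerAr; apply: double_cosetZ.
        rewrite sigma_sq; apply: dc_add; last exact/dc_base/gen_scal.
        exact/double_cosetZ/double_coset_sigma.
      * by rewrite mulrDr; apply: dc_add.
    + by rewrite mulrDl; apply: dc_add.
have comm t : gen_by (ltn^~ n) t -> s n.+1 * t = t * s n.+1.
  by apply: gen_far_sigma => l /= lt_ln; apply/orP; right; rewrite !ltnS.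
have up t : gen_by (ltn^~ n) t -> gen_by (ltn^~ n.+1) t.
  by apply: gen_sub => m /= /ltnW.
have gs : gen_by (ltn^~ n.+1) (s n) by apply: gen_sigma => /=.
have core t : gen_by (ltn^~ n.+1) t -> double_coset n.+1 (s n.+1 * t * s n.+1).
  move=> /IHn; elim=> {t} [t gt|t u gt gu|t u _ IHt _ IHu].
  - rewrite comm // -mulrA; apply: double_coset_mull; first exact: up.
    rewrite sigma_sq; apply: dc_add; last exact/dc_base/gen_scal.
    exact/double_cosetZ/double_coset_sigma.
  - have -> : s n.+1 * (t * s n * u) * s n.+1
            = t * (s n.+1 * s n * s n.+1) * u.
      by rewrite !mulrA (comm t) // -!mulrA (comm u).
    apply: double_coset_mulr; first exact: up.
    apply: double_coset_mull; first exact: up.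
    by rewrite -sigma_braid; apply: dc_gen.
  - by rewrite mulrDr mulrDl; apply: dc_add.
elim=> [m|a|y z _ IHy _ IHz|y z _ IHy _ IHz].
- rewrite /= ltnS leq_eqVlt => /orP[/eqP ->|lt_m]; first exact: double_coset_sigma.
  exact/dc_base/gen_sigma.
- exact/dc_base/gen_scal.
- exact: dc_add.
- elim: IHy => {y} [y gy|y t gy gt|y t _ IH1 _ IH2].
  + exact: double_coset_mull.
  + rewrite -!mulrA; apply: double_coset_mull => //.
    elim: IHz => {z} [z gz|z u gz gu|z u _ IH1 _ IH2].
    * rewrite mulrA; do 2!apply: double_coset_mulr => //.
      exact: double_coset_sigma.
    * rewrite !mulrA; apply: double_coset_mulr => //.
      by rewrite -[_ * t * z]mulrA; apply/core/gen_mul.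
    * by rewrite !mulrDr; apply: dc_add.
  + by rewrite mulrDl; apply: dc_add.
Qed.

(** Indices decrease from left to right. A run of marks is one of the elements
    zeta; an unmarked index separates two consecutive blocks of strands. *)
Fixpoint word (j : nat) (bs : seq bool) : H :=
  if bs is b :: bs' then word j.+1 bs' * (if b then s j else 1) else 1.

Lemma gen_word j bs : gen_by (fun i => (j <= i < j + size bs)%N) (word j bs).
Proof.
elim: bs j => [|b bs IH] j /=; first exact: gen_one.
apply: gen_mul.
  by apply: gen_sub (IH j.+1) => i /=; rewrite addSnnS => /andP[/ltnW -> ->].
case: b; last exact: gen_one.
by apply: gen_sigma; rewrite leqnn /= addnS ltnS leq_addr.
Qed.

Lemma word_cat j bs1 bs2 :
  word j (bs1 ++ bs2) = word (j + size bs1) bs2 * word j bs1.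
Proof.
elim: bs1 j => [|b bs1 IH] j /=; first by rewrite addn0 mulr1.
by rewrite IH mulrA addSnnS.
Qed.

Lemma gen_bounded x : exists n, gen_by (ltn^~ n) x.
Proof.
elim/hecke_gen_ind: x => [m|a|x y [n gx] [p gy]|x y [n gx] [p gy]].
- by exists m.+1; apply: gen_sigma => /=.
- by exists 0%N; apply: gen_scal.
- exists (maxn n p); apply: gen_add; [apply: gen_sub gx|apply: gen_sub gy];
  by move=> m /=; rewrite leq_max => ->; rewrite ?orbT.
- exists (maxn n p); apply: gen_mul; [apply: gen_sub gx|apply: gen_sub gy];
  by move=> m /=; rewrite leq_max => ->; rewrite ?orbT.
Qed.

(** Modulo commutators every element is a combination of words. An element of
    [H_(n+1)] multiplied by a word in later generators is treated through its
    double coset decomposition: the factors from [H_n] commute with the later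
    word, so the cyclicity of [d] gathers them on one side and [s n] joins the
    word, marked or not. *)
Lemma trace_determined (d : {scalar H}) :
  (forall A B, d (A * B) = d (B * A)) ->
  (forall bs, d (word 0 bs) = 0) -> forall x, d x = 0.
Proof.
move=> dC d0 x.
suff main n y bs : gen_by (ltn^~ n) y -> d (word n bs * y) = 0.
  have [n gx] := gen_bounded x.
  by have := main n x [::] gx; rewrite /= mul1r.
elim: n y bs => [|n IHn] y bs gy.
  have [a ->] := gen_by0 gy.
  by rewrite -scalerAr mulr1 linearZ /= d0 mulr0.
have comm t : gen_by (ltn^~ n) t -> word n.+1 bs * t = t * word n.+1 bs.
  move=> gt; apply: gen_far (gen_word _ _) gt => m l /andP[h _] /= l_n.
  by apply/orP; right; apply: leq_trans h; rewrite !ltnS.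
move: gy => /double_cosetP; elim=> {y} [y gy|y z gy gz|y z _ IHy _ IHz].
- by have := IHn y (false :: bs) gy; rewrite /= mulr1.
- have -> : word n.+1 bs * (y * s n * z) = y * (word n.+1 bs * s n * z).
    by rewrite !mulrA comm.
  rewrite dC -[_ * y]mulrA; exact: (IHn (z * y) (true :: bs) (gen_mul gz gy)).
- by rewrite mulrDr linearD /= IHy IHz addr0.
Qed.

End HeckeWords.

(** * Permuting the blocks of a word *)

Section BlockSwap.
Variables (C : fieldType) (q : C).
Hypothesis q_neq0 : q != 0.
Local Notation H := (hecke_alg q).
Local Notation s := (@sigma C q).

Fixpoint ascending (k a : nat) : H :=
  if a is a'.+1 then ascending k a' * s (k + a') else 1.

Lemma gen_ascending k a : gen_by (fun i => (k <= i < k + a)%N) (ascending k a).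
Proof.
elim: a => [|a IH] /=; first exact: gen_one.
apply: gen_mul; last by apply: gen_sigma; rewrite leq_addr addnS ltnSn.
by apply: gen_sub IH => i /andP[-> /= h]; rewrite addnS ltnW.
Qed.

(** The braid carries a block of [a] strands past the strand that follows it. *)
Lemma ascending_shift k a i : (k <= i)%N -> (i.+1 < k + a)%N ->
  ascending k a * s i = s i.+1 * ascending k a.
Proof.
elim: a i => [|a IHa] i ki; first by rewrite addn0; lia.
rewrite addnS ltnS leq_eqVlt => /orP[/eqP e|lt_i] /=.
  case: a e {IHa} => [|a] e; first by lia.
  have -> : i = (k + a)%N by lia.
  rewrite /= addnS -!mulrA [X in ascending k a * X]mulrA sigma_braid -!mulrA.
  rewrite !mulrA; congr (_ * _ * _); symmetry.
  apply: gen_far_sigma (gen_ascending k a) => l; lia.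
rewrite -mulrA (@sigma_far _ _ (k + a)) ?mulrA ?IHa //; lia.
Qed.

(** Two such braids in a row move two strands below the block, hence carry the
    generator of these strands along. *)
Lemma ascending2 k a :
  ascending k.+1 a * ascending k a * s (k + a)
  = s k * ascending k.+1 a * ascending k a.
Proof.
elim: a => [|a IHa] /=; first by rewrite addn0 !mulr1 mul1r.
have comm : s (k.+1 + a) * ascending k a = ascending k a * s (k.+1 + a).
  by apply: gen_far_sigma (gen_ascending k a) => l; lia.
have -> : ascending k.+1 a * s (k.+1 + a) * (ascending k a * s (k + a)) * s (k + a.+1)
  = ascending k.+1 a * (s (k.+1 + a) * ascending k a) * s (k + a) * s (k + a.+1).
  by rewrite !mulrA.
have -> : s k * (ascending k.+1 a * s (k.+1 + a)) * (ascending k a * s (k + a))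
  = s k * ascending k.+1 a * (s (k.+1 + a) * ascending k a) * s (k + a).
  by rewrite !mulrA.
rewrite comm !mulrA -IHa addnS addSn.
by rewrite -!mulrA; congr (_ * (_ * _)); rewrite !mulrA sigma_braid.
Qed.

(** The braid exchanging a block of [a] strands with the [b] strands after it. *)
Fixpoint crossing (a b n : nat) : H :=
  if b is b'.+1 then crossing a b' n.+1 * ascending n a else 1.

Lemma gen_crossing a b n :
  gen_by (fun i => (n <= i)%N && (i.+1 < n + a + b)%N) (crossing a b n).
Proof.
elim: b n => [|b IH] n /=; first exact: gen_one.
apply: gen_mul.
  by apply: gen_sub (IH n.+1) => i /=; lia.
by apply: gen_sub (gen_ascending n a) => i /=; lia.
Qed.

Lemma crossing_left a b n i : (n <= i)%N -> (i.+1 < n + a)%N ->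
  crossing a b n * s i = s (b + i) * crossing a b n.
Proof.
elim: b n i => [|b IH] n i ni ia /=; first by rewrite mulr1 mul1r.
rewrite -mulrA ascending_shift // mulrA IH ?addnS ?mulrA //; lia.
Qed.

Lemma crossing_right a b n j : (j.+1 < b)%N ->
  crossing a b n * s (n + a + j) = s (n + j) * crossing a b n.
Proof.
elim: b n j => // b IH n [|j] /=.
  rewrite !addn0; case: b IH => [//|b] _ _ /=.
  rewrite -!mulrA [X in _ * X]mulrA ascending2 -!mulrA !mulrA; congr (_ * _ * _).
  by symmetry; apply: gen_far_sigma (gen_crossing _ _ _) => l; lia.
rewrite ltnS => jb.
have -> : crossing a b n.+1 * ascending n a * s (n + a + j.+1)
        = crossing a b n.+1 * s (n.+1 + a + j) * ascending n a.
  rewrite -!mulrA; congr (_ * _); rewrite -addSnnS -addSn; symmetry.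
  by apply: gen_far_sigma (gen_ascending n a) => l; lia.
by rewrite IH // mulrA addSnnS.
Qed.

Lemma word_conj P j j' bs :
  (forall i, (i < size bs)%N -> P * s (j + i) = s (j' + i) * P) ->
  P * word q j bs = word q j' bs * P.
Proof.
elim: bs j j' => [|b bs IH] j j' h /=; first by rewrite mulr1 mul1r.
rewrite mulrA (IH _ j'.+1) => [|i hi]; last by rewrite !addSnnS h.
rewrite -!mulrA; congr (_ * _); have := h 0%N isT; rewrite !addn0.
by case: b {h} => // _; rewrite mulr1 mul1r.
Qed.

Lemma word_comm j1 bs1 j2 bs2 : (j1 + size bs1 < j2)%N ->
  word q j1 bs1 * word q j2 bs2 = word q j2 bs2 * word q j1 bs1.
Proof.
move=> h; apply: gen_far (gen_word q j1 bs1) (gen_word q j2 bs2) => m l /=; lia.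
Qed.

Lemma crossing_blocks k l n (bk := nseq k true) (bl := nseq l true) :
  crossing k.+1 l.+1 n * (word q (n + k.+1) bl * word q n bk)
  = word q (n + l.+1) bk * word q n bl * crossing k.+1 l.+1 n.
Proof.
rewrite mulrA (@word_conj _ (n + k.+1) n) => [|i]; last first.
  by rewrite size_nseq => h; apply: crossing_right.
rewrite -mulrA (@word_conj _ n (n + l.+1)) => [|i]; last first.
  by rewrite size_nseq => h; rewrite crossing_left; do ?[congr (s _ * _)]; lia.
by rewrite mulrA word_comm // size_nseq; lia.
Qed.

Definition invertible (x : H) := exists y, y * x = 1 /\ x * y = 1.

Lemma invertibleM x y : invertible x -> invertible y -> invertible (x * y).
Proof.
move=> [x' [x'x xx']] [y' [y'y yy']]; exists (y' * x'); split.
  by rewrite mulrA -[y' * x' * x]mulrA x'x mulr1.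
by rewrite mulrA -[x * y * y']mulrA yy' mulr1.
Qed.

Lemma invertible1 : invertible 1.
Proof. by exists 1; rewrite mulr1. Qed.

Lemma sigma_invertible m : invertible (s m).
Proof.
exists (q^-1 *: (s m - (q - 1)%:A)).
have e : q^-1 *: ((q - 1) *: s m + q *: 1 - (q - 1) *: s m) = 1 :> H.
  by rewrite addrAC subrr add0r scalerA mulVf // scale1r.
by split; [rewrite -scalerAl mulrBl | rewrite -scalerAr mulrBr];
   rewrite sigma_sq -?scalerAl -?scalerAr ?mul1r ?mulr1.
Qed.

Lemma crossing_invertible a b n : invertible (crossing a b n).
Proof.
elim: b n => [|b IH] n /=; first exact: invertible1.
apply: invertibleM => //.
by elim: a {IH} => [|a IHa] /=; [exact: invertible1|exact/invertibleM/sigma_invertible].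
Qed.

(** The parts of the composition are diminished by one: a block of [k.+1] strands
    involves [k] generators. The last separator contributes the factor 1. *)
Definition block_mask (c : seq nat) : seq bool :=
  flatten [seq rcons (nseq k true) false | k <- c].

Lemma word_rcons_false j bs : word q j (rcons bs false) = word q j bs.
Proof. by rewrite -cats1 word_cat /= !mul1r. Qed.

Lemma word_block_cons j k c : word q j (block_mask (k :: c))
  = word q (j + k.+1) (block_mask c) * word q j (nseq k true).
Proof.
by rewrite /block_mask /= word_cat word_rcons_false size_rcons size_nseq.
Qed.

Lemma word_block_cat j c1 c2 : word q j (block_mask (c1 ++ c2))
  = word q (j + size (block_mask c1)) (block_mask c2) * word q j (block_mask c1).
Proof. by rewrite /block_mask map_cat flatten_cat word_cat. Qed.

Lemma gen_word_block j c :
  gen_by (fun i => (j <= i)%N && (i.+1 < j + size (block_mask c))%N)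
    (word q j (block_mask c)).
Proof.
elim: c j => [|k c IH] j; first exact: gen_one.
rewrite word_block_cons.
have -> : size (block_mask (k :: c)) = (k.+1 + size (block_mask c))%N.
  by rewrite /block_mask /= size_cat size_rcons size_nseq.
apply: gen_mul; [apply: gen_sub (IH _) => i /=|
  apply: gen_sub (gen_word _ _ _) => i /=; rewrite size_nseq]; lia.
Qed.

(** The crossing of two adjacent blocks is invertible, commutes with all other
    blocks, and conjugates the product of the two blocks into the product in
    the other order. *)
Lemma trace_block_swap (d : H -> C) pre k l post :
  (forall A B, d (A * B) = d (B * A)) ->
  d (word q 0 (block_mask (pre ++ k :: l :: post)))
  = d (word q 0 (block_mask (pre ++ l :: k :: post))).
Proof.
move=> dC; rewrite !word_block_cat !word_block_cons add0n.
set N := size _; have -> : (N + l.+1 + k.+1 = N + k.+1 + l.+1)%N by lia.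
set Y := word q (N + _ + _) _; set X := word q 0 _.
have [P' [P'P PP']] := crossing_invertible k.+1 l.+1 N.
have := crossing_blocks k l N; set P := crossing _ _ _ => swap.
have gP : gen_by (fun i => (N <= i)%N && (i.+1 < N + k.+1 + l.+1)%N) P.
  exact: gen_crossing.
have PX : P * X = X * P.
  by symmetry; apply: gen_far (gen_word_block _ _) gP => m p /=; rewrite -/N; lia.
have PY : P * Y = Y * P.
  by symmetry; apply: gen_far (gen_word _ _ _) gP => m p /=; lia.
suff conj A B : P * A = B * P -> d (Y * A * X) = d (Y * B * X).
  by rewrite -[Y * _ * _]mulrA -[in RHS](mulrA Y); exact: conj swap.
move=> AB; rewrite -[Y * A * X]mul1r -P'P -mulrA dC !mulrA PY.
by rewrite -[Y * P * A]mulrA AB mulrA -(mulrA _ P X) PX mulrA -(mulrA _ P P') PP' mulr1.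
Qed.

Lemma trace_block_perm (d : {scalar H}) c c' :
  (forall A B, d (A * B) = d (B * A)) -> perm_eq c c' ->
  d (word q 0 (block_mask c)) = d (word q 0 (block_mask c')).
Proof.
move=> dC cc'; pose F c0 := d (word q 0 (block_mask c0)).
have swap s1 s2 s3 s0 : F (s0 ++ s1 ++ s2 ++ s3) = F (s0 ++ s2 ++ s1 ++ s3).
  elim: s1 s0 => // x s1 IH s0.
  rewrite -[x :: s1]cat1s -!catA (catA s0) IH -!catA.
  elim: s2 s0 {IH} => // y s2 IH s0.
  rewrite /= [LHS](@trace_block_swap d s0) //.
  by have := IH (rcons s0 y); rewrite !cat_rcons.
apply: (catCA_perm_ind (P := fun c0 => F c = F c0) _ cc') => // s1 s2 s3.
by have /= -> := swap s1 s2 s3 [::].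
Qed.

Lemma block_maskP bs : exists c, rcons bs false = block_mask c.
Proof.
elim: bs => [|b bs [c e]]; first by exists [:: 0%N].
case: c e => [|k c] e; first by case: bs e.
case: b; last by exists (0%N :: k :: c); rewrite rcons_cons e.
by exists (k.+1 :: c); rewrite rcons_cons e.
Qed.

Lemma trace_determined_sorted (d : {scalar H}) :
  (forall A B, d (A * B) = d (B * A)) ->
  (forall c, sorted geq c -> d (word q 0 (block_mask c)) = 0) ->
  forall x, d x = 0.
Proof.
move=> dC d0; apply: trace_determined => // bs.
have [c e] := block_maskP bs; rewrite -word_rcons_false e.
rewrite (@trace_block_perm d _ (sort geq c)) ?d0 //.
  by apply: sort_sorted => m n; apply: leq_total.
by rewrite perm_sym perm_sort.
Qed.

End BlockSwap.

Lemma zeta_word (R : realType) (q : R) j k :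
  zeta q j (j + k) = word q%:C j (nseq k true).
Proof.
rewrite /zeta /index_iota addnC addnK.
elim: k j => [|k IH] j /=; first by rewrite big_nil.
by rewrite rev_cons -cats1 big_cat big_seq1 /= IH.
Qed.

(** The product lists the blocks in the opposite order; distant blocks commute. *)
Lemma zeta_part_word (R : realType) (q : R) (c : seq nat) :
  zeta_part q [seq k.+1 | k <- c] = word q%:C 0 (block_mask c).
Proof.
rewrite /zeta_part size_map.
suff main j : \prod_(0 <= i < size c)
    zeta q (j + sumn (take i [seq k.+1 | k <- c]))
           (j + sumn (take i.+1 [seq k.+1 | k <- c])).-1
    = word q%:C j (block_mask c).
  by have := main 0%N.
elim: c j => [|k c IH] j; first by rewrite big_geq.
rewrite word_block_cons big_nat_recl //= take0 /= !addn0 addnS zeta_word.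
under eq_bigr do rewrite !addnA addnS.
rewrite IH -addnS; symmetry.
have far m l : (j + k.+1 <= m < j + k.+1 + size (block_mask c))%N ->
    (j <= l < j + size (nseq k true))%N -> (m.+1 < l)%N || (l.+1 < m)%N.
  by rewrite size_nseq; lia.
exact: gen_far far (gen_word _ _ _) (gen_word _ _ _).
Qed.

(** * Newton identities for chains *)

Section Convolution.
Variable K : comNzRingType.

(** [y i] is the coefficient of [z ^ i.+1], [g i] that of [z ^ i]. *)
Definition convol (y g : nat -> K) (m : nat) : K := \sum_(i < m) y i * g (m - i.+1)%N.

(** The coefficients of [1 + t * F(z)]. Keeping [F] itself allows [t = 0], which
    is the case of the symmetric groups. *)
Definition withone (t : K) (F : nat -> K) (m : nat) : K :=
  if m is 0 then 1 else t * F m.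

Lemma convolDl y1 y2 g m : convol (fun i => y1 i + y2 i) g m = convol y1 g m + convol y2 g m.
Proof. by rewrite /convol -big_split; apply: eq_bigr => i _; rewrite mulrDl. Qed.

Lemma convolZl a y g m : convol (fun i => a * y i) g m = a * convol y g m.
Proof. by rewrite /convol mulr_sumr; apply: eq_bigr => i _; rewrite mulrA. Qed.

Lemma convolSl y g m : convol y g m.+1 = y 0%N * g m + convol (fun i => y i.+1) g m.
Proof. by rewrite /convol big_ord_recl /= subn1. Qed.

Lemma convol_rec (u u' : K) (g g' y : nat -> K) m : g 0%N = g' 0%N ->
  (forall j, g j.+1 = u * g j + g' j.+1 - u' * g' j) ->
  convol y g m.+1 = u * convol y g m + convol y g' m.+1 - u' * convol y g' m.
Proof.
move=> g0 gS; rewrite /convol !big_ord_recr /= subnn g0.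
set S := \sum_(i < m) _; set S1 := \sum_(i < m) _; set S2 := \sum_(i < m) _.
set S3 := \sum_(i < m) _.
suff -> : S = u * S1 + S2 - u' * S3 by ring.
rewrite /S /S1 /S2 /S3 !mulr_sumr -sumrN -!big_split; apply: eq_bigr => i _ /=.
by rewrite subSS -(subnSK (ltn_ord i)) gS; ring.
Qed.

Section AddVariable.
Variables (a u u' t : K) (F F' y' : nat -> K).
Hypothesis ut : u - u' = t * a.
Hypotheses (F0 : F 0%N = 0) (F'0 : F' 0%N = 0).
Hypothesis FS : forall m,
  F m.+1 = u * F m + F' m.+1 - u' * F' m + a * (m == 0%N)%:R.
Hypothesis newton' : forall m, F' m *+ m = convol y' (withone t F') m.

Let g := withone t F.
Let g' := withone t F'.
Let D i := a * \sum_(l < i.+1) u ^+ (i - l) * u' ^+ l.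
Let Z m := convol (fun i => u' ^+ i) g m.+1.

Let gS j : g j.+1 = u * g j + g' j.+1 - u' * g' j.
Proof.
rewrite /g /g'; case: j => [|j] /=; rewrite FS /=.
  rewrite F0 F'0; have -> : u = u' + t * a by rewrite -ut; ring.
  by rewrite !mulr0 !mulr1; ring.
by rewrite mulr0 addr0; ring.
Qed.

Let ZS m : Z m.+1 = u * Z m + g' m.+1.
Proof.
rewrite /Z (convol_rec _ _ (g' := g') (u := u) (u' := u')) //.
rewrite [convol _ g' m.+2]convolSl expr0 mul1r.
have -> : convol (fun i => u' ^+ i.+1) g' m.+1 = u' * convol (fun i => u' ^+ i) g' m.+1.
  by rewrite -convolZl /convol; apply: eq_bigr => i _; rewrite exprS.
by ring.
Qed.

(* [Z] has the generating function [g(z) / (1 - u' * z)]. *)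
Let aZ m : a * Z m = u * F m - u' * F' m + a * (m == 0%N)%:R.
Proof.
elim: m => [|m IH].
  by rewrite F0 F'0 /Z /convol big_ord1 /= expr0; ring.
rewrite ZS mulrDr mulrCA IH FS /= mulr0 addr0.
have -> : u' = u - t * a by rewrite -ut; ring.
by rewrite /g' /=; ring.
Qed.

Let DS i : D i.+1 = u * D i + a * u' ^+ i.+1.
Proof.
rewrite /D big_ord_recr /= subnn expr0 mul1r mulrDr mulrCA; congr (_ + _).
congr (_ * _); rewrite mulr_sumr; apply: eq_bigr => l _.
by rewrite subSn ?exprS ?mulrA // -ltnS.
Qed.

Let convolD m : convol D g m.+1 = u * convol D g m + a * Z m.
Proof.
have e : convol (fun i => D i.+1) g m
       = u * convol D g m + a * convol (fun i => u' ^+ i.+1) g m.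
  rewrite -!convolZl -convolDl /convol.
  by apply: eq_bigr => i _; rewrite DS.
have -> : Z m = g m + convol (fun i => u' ^+ i.+1) g m.
  by rewrite /Z convolSl expr0 mul1r.
by rewrite convolSl e /D big_ord1 !expr0; ring.
Qed.

(** Multiplying the generating function [1 + t * F'(z)] by
    [(1 - u' * z) / (1 - u * z)] adds [u ^+ m - u' ^+ m] to the coefficients of
    [z] times its logarithmic derivative. Here everything has been divided by
    [t], since [u - u'] is a multiple of [t]. *)
Lemma newton_add m : F m *+ m = convol (fun i => y' i + D i) (withone t F) m.
Proof.
elim: m => [|m IH]; first by rewrite mulr0n /convol big_ord0.
rewrite -/g convolDl (convol_rec y' _ (g' := g') (u := u) (u' := u')) //.
rewrite -!newton' convolD.
have -> : u * convol y' g m + F' m.+1 *+ m.+1 - u' * (F' m *+ m)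
   + (u * convol D g m + a * Z m)
   = u * (convol y' g m + convol D g m) + F' m.+1 *+ m.+1 - u' * (F' m *+ m) + a * Z m.
  by ring.
rewrite -convolDl -IH aZ FS.
have collect n (A B E : K) :
    A *+ n + B *+ n.+1 - E *+ n + (A - E) = (A + B - E) *+ n.+1.
  rewrite mulrnBl mulrnDl (mulrSr A) (mulrSr E).
  by move: (A *+ n) (B *+ n.+1) (E *+ n) => *; ring.
case: m {IH} => [|m]; last by rewrite !mulr0 !addr0 !mulrnAr collect.
by rewrite F0 F'0 ?mul0rn !mulr0 !mulr1n !subr0 !add0r.
Qed.

End AddVariable.
End Convolution.

(** Sums over sequences of letters: a letter contributes its weight [p], and a
    marked pair of neighbours contributes [d]. *)
Section Chains.
Variables (K : comNzRingType) (I : eqType) (p : I -> K) (d : I -> I -> K).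

Fixpoint chain (S : seq I) (bs : seq bool) (c : I) : K :=
  if bs is b :: bs' then
    \sum_(c' <- S) p c' * ((if b then d c c' else 1) * chain S bs' c')
  else 1.

Definition chains (S : seq I) (bs : seq bool) : K :=
  \sum_(c <- S) p c * chain S bs c.

Lemma chains_block S k bs : chains S (rcons (nseq k true) false ++ bs)
  = chains S (nseq k true) * chains S bs.
Proof.
rewrite /chains mulr_suml; apply: eq_bigr => c _; rewrite -mulrA; congr (_ * _).
elim: k c => [|k IH] c /=.
  by rewrite mul1r; apply: eq_bigr => i _; rewrite mul1r.
by rewrite mulr_suml; apply: eq_bigr => i _; rewrite IH !mulrA.
Qed.

Lemma chains_block_mask S c : chains S (block_mask c)
  = \prod_(k <- c) chains S (nseq k true) * chains S [::].
Proof.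
elim: c => [|k c IH]; first by rewrite big_nil mul1r.
by rewrite /block_mask /= chains_block -/(block_mask c) IH big_cons mulrA.
Qed.

Definition chainF (S : seq I) (m : nat) : K :=
  if m is m'.+1 then chains S (nseq m' true) else 0.

(** Adding a letter [x] smaller than all others. A weakly increasing sequence
    starts with a number of copies of [x]; removing one copy gives the
    recursion that says that the generating function is multiplied by
    [(1 - u' * z) / (1 - u * z)] with [u = p x * d x x], [u' = p x * (d x x - t)]. *)
Lemma chainF_cons (t : K) x S m :
  (forall c, c \in S -> d c x = 0) -> (forall c, c \in S -> d x c = t) ->
  chainF (x :: S) m.+1 = p x * d x x * chainF (x :: S) m + chainF S m.+1
    - p x * (d x x - t) * chainF S m + p x * (m == 0%N)%:R.
Proof.
move=> d0 dt.
have eqS k c : c \in S -> chain (x :: S) (nseq k true) c = chain S (nseq k true) c.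
  elim: k c => //= k IH c cS; rewrite big_cons d0 // mul0r mulr0 add0r.
  by rewrite !big_seq; apply: eq_bigr => e eS; rewrite IH.
have split k : chains (x :: S) (nseq k true)
    = p x * chain (x :: S) (nseq k true) x + chains S (nseq k true).
  rewrite /chains big_cons; congr (_ + _).
  by rewrite !big_seq; apply: eq_bigr => e eS; rewrite eqS.
rewrite /chainF; case: m => [|k]; first by rewrite split /=; ring.
rewrite split [chains _ (nseq k true)]split /= big_cons.
have -> : \sum_(j <- S) p j * (d x j * chain (x :: S) (nseq k true) j)
        = t * chains S (nseq k true).
  rewrite /chains mulr_sumr !big_seq; apply: eq_bigr => e eS.
  by rewrite dt // eqS // mulrCA.
by rewrite mulr0; ring.
Qed.

Lemma chainF_newton (t : K) (S : seq I) (r : rel I) :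
  (forall x y, r x y -> d y x = 0) -> (forall x y, r x y -> d x y = t) ->
  pairwise r S ->
  forall m, chainF S m *+ m
    = convol (fun i => \sum_(x <- S) p x * \sum_(l < i.+1)
              (p x * d x x) ^+ (i - l) * (p x * (d x x - t)) ^+ l)
        (withone t (chainF S)) m.
Proof.
move=> r0 rt; elim: S => [_ m|x S IH /= /andP[/allP rx pS] m].
  rewrite /convol big1 => [|i _]; last by rewrite big_nil mul0r.
  by case: m => [|m]; rewrite /= ?mulr0n // /chains big_nil mul0rn.
under [X in convol X _ _]eq_fun do rewrite big_cons addrC.
apply: (newton_add (F' := chainF S) (u := p x * d x x)) => //; last exact: IH.
  by ring.
by move=> k; apply: chainF_cons => c /rx; [apply: r0|apply: rt].
Qed.

End Chains.

(** * The sum over cycle types *)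

Section CycleIndex.
Variable K : numFieldType.
Implicit Type x : nat -> K.

(** The complete symmetric function expressed through power sums; [x i] stands
    for the power sum of degree [i.+1]. *)
Definition cycle_sum x m : K :=
  \sum_(mu : {ffun 'I_m -> 'I_m.+1} | (\sum_(i < m) i.+1 * mu i == m)%N)
    \prod_(i < m) (x i ^+ mu i / (i.+1%:R ^+ mu i * (mu i)`!%:R)).

Definition eq_upto N (p r : {poly K}) := exists s, p = r + 'X^(N.+1) * s.

Lemma eq_upto_coef N p r k : (k <= N)%N -> eq_upto N p r -> p`_k = r`_k.
Proof. by move=> kN [s ->]; rewrite coefD coefXnM ltnS kN addr0. Qed.

(** The exponential of [x i * 'X^i.+1 / i.+1], truncated. *)
Definition cyc_factor N x i : {poly K} :=
  \sum_(j < N.+1) (x i ^+ j / (i.+1%:R ^+ j * j`!%:R)) *: 'X^(i.+1 * j).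

Definition cyc_poly N x := \prod_(i < N) cyc_factor N x i.

Lemma coef_cyc_poly m x : (cyc_poly m x)`_m = cycle_sum x m.
Proof.
rewrite /cyc_poly /cyc_factor bigA_distr_bigA coef_sum /cycle_sum big_mkcond /=.
rewrite [RHS]big_mkcond /=; apply: eq_bigr => mu _.
rewrite scaler_prod coefZ.
have -> : \prod_(i < m) 'X^(i.+1 * mu i) = 'X^(\sum_(i < m) i.+1 * mu i) :> {poly K}.
  by elim/big_rec2: _ => [|i n p _ ->]; rewrite ?expr0 // exprD.
by rewrite coefXn eq_sym; case: ifP => _; rewrite ?mulr1 ?mulr0.
Qed.

Lemma cyc_factor_deriv N x i :
  eq_upto N ('X * (cyc_factor N x i)^`()) ((x i *: 'X^(i.+1)) * cyc_factor N x i).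
Proof.
pose c j := x i ^+ j / (i.+1%:R ^+ j * j`!%:R).
have cS j : c j.+1 * (i.+1 * j.+1)%:R = x i * c j.
  rewrite /c !exprS factS !natrM; field.
  by rewrite !nat1r ?expf_neq0 ?pnatr_eq0 -?lt0n ?fact_gt0.
exists (- ((x i * c N) *: 'X^(i.+1 * N.+1 - N.+1))).
rewrite mulrN -scalerAr -exprD subnKC ?leq_pmull //.
rewrite /cyc_factor raddf_sum [in LHS]big_ord_recl /= muln0 expr0 derivZ derivC.
rewrite scaler0 add0r [in RHS]big_ord_recr /= mulrDr.
have -> : x i *: 'X^(i.+1) * ((x i ^+ N / (i.+1%:R ^+ N * N`!%:R)) *: 'X^(i.+1 * N))
        = (x i * c N) *: 'X^(i.+1 * N.+1).
  by rewrite -scalerAl -scalerAr scalerA -exprD mulnS.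
rewrite addrK !mulr_sumr.
apply: eq_bigr => j _.
rewrite derivZ derivXn -/(c j) -[bump 0 j]/(j.+1) -/(c j.+1).
rewrite -scaler_nat scalerA cS -scalerAr -exprS prednK ?muln_gt0 //.
by move: (c j) => e; rewrite mulnS exprD -scalerAl -[in RHS]scalerAr [RHS]scalerA.
Qed.

Lemma eq_uptoM N p p' r : eq_upto N p p' -> eq_upto N (p * r) (p' * r).
Proof. by move=> [s ->]; exists (s * r); rewrite mulrDl mulrA. Qed.

Lemma eq_uptoD N p p' r r' :
  eq_upto N p p' -> eq_upto N r r' -> eq_upto N (p + r) (p' + r').
Proof. by move=> [s ->] [s' ->]; exists (s + s'); ring. Qed.

(** The logarithmic derivative of a product of exponentials is a sum; the
    truncation is only felt beyond degree [N]. *)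
Lemma cyc_poly_deriv N x : eq_upto N ('X * (cyc_poly N x)^`())
  ((\sum_(i < N) x i *: 'X^(i.+1)) * cyc_poly N x).
Proof.
rewrite /cyc_poly; elim/big_rec2: _ => [|i s p _ IH].
  by exists 0; rewrite derivC !mulr0 mul0r addr0.
rewrite derivM mulrDr !mulrDl.
apply: eq_uptoD.
  rewrite mulrA [X in eq_upto _ _ X]mulrA.
  exact/eq_uptoM/cyc_factor_deriv.
rewrite mulrCA [X in eq_upto _ _ X]mulrCA.
rewrite [X in eq_upto _ X _]mulrC [X in eq_upto _ _ X]mulrC.
exact: eq_uptoM.
Qed.

Lemma cyc_poly_newton N x k : (k <= N)%N ->
  (cyc_poly N x)`_k *+ k = convol x (fun j => (cyc_poly N x)`_j) k.
Proof.
move=> kN; have := eq_upto_coef kN (cyc_poly_deriv N x).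
rewrite coefXM mulr_suml coef_sum.
have -> : (if k == 0%N then 0 else (cyc_poly N x)^`()`_k.-1) = (cyc_poly N x)`_k *+ k.
  by case: k {kN} => [|k] /=; rewrite ?mulr0n // coef_deriv.
move=> ->; rewrite /convol (big_ord_widen N (fun i => x i * (cyc_poly N x)`_(k - i.+1))) //.
rewrite [RHS]big_mkcond /=; apply: eq_bigr => i _.
by rewrite -scalerAl coefZ coefXnM ltnS leqNgt; case: ltnP; rewrite ?mulr0.
Qed.

Lemma cyc_poly0 N x : (cyc_poly N x)`_0 = 1.
Proof.
rewrite -horner_coef0 /cyc_poly horner_prod big1 // => i _.
rewrite /cyc_factor horner_sum big_ord_recl /= big1 => [|j _].
  by rewrite muln0 !expr0 fact0 mulr1 divr1 scale1r hornerC addr0.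
by rewrite hornerZ hornerXn expr0n /= mulr0.
Qed.

(** The coefficients of [cyc_poly N x] of degree at most [N] satisfy the Newton
    recursion, hence do not depend on [N]. *)
Lemma cycle_sum_newton x m : cycle_sum x m *+ m = convol x (cycle_sum x) m.
Proof.
have main k N p : (k <= N)%N -> (k <= p)%N -> (cyc_poly N x)`_k = (cyc_poly p x)`_k.
  elim/ltn_ind: k => -[_ _ _|k IH kN kp]; first by rewrite !cyc_poly0.
  apply: (@pmulrnI _ k.+1) => //; rewrite !cyc_poly_newton //.
  by apply: eq_bigr => i _; rewrite IH //; lia.
rewrite -coef_cyc_poly cyc_poly_newton //; apply: eq_bigr => i _.
by rewrite -coef_cyc_poly (main _ _ (m - i.+1)%N) // leq_subr.
Qed.

End CycleIndex.

(** * The values on single cycles *)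

Lemma cvg_bigsum (K : numFieldType) (E : normedModType K) (T I : Type)
    (F : set_system T) {FF : Filter F} (r : seq I) (f : I -> T -> E) (l : I -> E) :
  (forall i, f i @ F --> l i) ->
  \sum_(i <- r) f i x @[x --> F] --> \sum_(i <- r) l i.
Proof.
move=> fl; elim: r => [|i r IH].
  by under eq_fun do rewrite big_nil; rewrite big_nil; exact: cvg_cst.
by under eq_fun do rewrite big_cons; rewrite big_cons; exact: cvgD.
Qed.

Lemma cvg_bigprod (K : numFieldType) (T I : Type)
    (F : set_system T) {FF : Filter F} (r : seq I) (f : I -> T -> K) (l : I -> K) :
  (forall i, f i @ F --> l i) ->
  \prod_(i <- r) f i x @[x --> F] --> \prod_(i <- r) l i.
Proof.
move=> fl; elim: r => [|i r IH].
  by under eq_fun do rewrite big_nil; rewrite big_nil; exact: cvg_cst.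
by under eq_fun do rewrite big_cons; rewrite big_cons; exact: cvgM.
Qed.

Section ZetaValues.
Variables (R : realType) (alpha beta : nat -> R).
Hypothesis psum1 : psum alpha beta 1 = 1.

Definition qpsum (q : R) i := (\sum_(l < i.+1) q ^+ l) * psum alpha beta i.+1.

(** The Newton identities for the values [F m] on the cycles of length [m],
    divided by [q - 1] and therefore meaningful at [q = 1]. *)
Definition newton_at (q : R) (F : nat -> R) :=
  forall m, F m *+ m = convol (qpsum q) (withone (q - 1) F) m.

Lemma zeta_formulaE m x : zeta_formula alpha beta m x
  = (x - 1)^-1 * cycle_sum (fun i => (x ^+ i.+1 - 1) * psum alpha beta i.+1) m.
Proof.
congr (_ * _); apply: eq_bigr => mu _.
rewrite [X in _ * X]big_mkcond -big_split; apply: eq_bigr => -[[|i] /= im] _ /=.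
  by rewrite psum1 !mulr1.
by rewrite exprMn mulrAC.
Qed.

Lemma cycle_sum0 (x : nat -> R) : cycle_sum x 0 = 1.
Proof. by rewrite -coef_cyc_poly cyc_poly0. Qed.

Lemma zeta_formula_newton x : x != 1 ->
  newton_at x (fun m => zeta_formula alpha beta m x).
Proof.
move=> x1 m; have x1' : x - 1 != 0 by rewrite subr_eq0.
apply: (mulfI x1'); rewrite mulrnAr zeta_formulaE mulVKf // cycle_sum_newton.
rewrite -convolZl; apply: eq_bigr => i _; congr (_ * _).
  by rewrite /qpsum mulrA -subrX1.
case: (m - i.+1)%N => [|k]; first by rewrite cycle_sum0.
by rewrite /withone zeta_formulaE mulVKf.
Qed.

(** The recursion has a unique solution and it is polynomial in [x]: this gives
    continuity at [x = 1]. *)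
Lemma newton_at_poly m : exists phi : nat -> {poly R},
  forall k x F, (0 < k <= m)%N -> newton_at x F -> F k = (phi k).[x].
Proof.
elim: m => [|m [phi IH]]; first by exists (fun=> 0) => -[].
pose new : {poly R} := m.+1%:R^-1 *:
  \sum_(i < m.+1) ((\sum_(l < i.+1) 'X^l) * (psum alpha beta i.+1)%:P)
    * withone ('X - 1) phi (m.+1 - i.+1)%N.
exists (fun k => if k == m.+1 then new else phi k) => k x F /andP[k0 km] FN.
case: eqP => [->|/eqP kNm]; last by apply: IH => //; lia.
apply: (@pmulrnI _ m.+1) => //; rewrite FN /new hornerZ -[RHS]mulr_natl mulVKf ?pnatr_eq0 //.
rewrite horner_sum; apply: eq_bigr => i _; rewrite !hornerM hornerC horner_sum.
congr (_ * _); first by congr (_ * _); apply: eq_bigr => l _; rewrite hornerXn.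
case e : (m.+1 - i.+1)%N => [|j] /=; first by rewrite hornerC.
by rewrite hornerM !hornerE (IH j.+1 x F) //; lia.
Qed.

Lemma zeta_value_newton q F m : (0 < m)%N -> newton_at q F ->
  F m = zeta_value alpha beta m q.
Proof.
move=> m0 FN; have [phi phiE] := newton_at_poly m.
rewrite (phiE m q F) ?m0 ?leqnn // /zeta_value.
have formE x : x != 1 -> zeta_formula alpha beta m x = (phi m).[x].
  move=> x1; have := phiE m x (fun m => zeta_formula alpha beta m x).
  by rewrite m0 leqnn; apply=> //; apply: zeta_formula_newton.
case: eqP => [->|/eqP/formE ->//]; symmetry; apply/cvg_lim => //.
apply: (@cvg_trans _ ((phi m).[x] @[x --> (1 : R)^'])).
  apply: near_eq_cvg; near=> x; rewrite formE //.
  by near: x; exact: nbhs_dnbhs_neq.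
apply: cvg_within_filter; exact: continuous_horner.
Unshelve. all: by end_near.
Qed.

Section TruncatedSums.
Variable q : R.

(** The squares of the coefficients of the vector [xi]. *)
Definition weight (a : znz) : R :=
  match val a with Posz n => alpha n.-1 | Negz n => beta n end.

(** The diagonal matrix entries of [R]. *)
Definition Rdiag (a c : znz) : R :=
  if a == c then if 0 < val a then q else - 1
  else if val a < val c then q - 1 else 0.

(** Listed in increasing order, so that letters are added at the small end. *)
Definition indices (n : nat) : seq znz :=
  [seq zneg j | j <- rev (iota 0 n)] ++ [seq zpos j | j <- iota 0 n].

Lemma big_indices (E : nmodType) n (f : znz -> E) : \sum_(a <- indices n) f a
  = \sum_(j < n) f (zneg j) + \sum_(j < n) f (zpos j).
Proof.
rewrite big_cat !big_map -!(big_mkord xpredT (fun j => f (_ j))) /index_iota subn0.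
by congr (_ + _); apply: perm_big; rewrite perm_rev.
Qed.

Lemma pairwise_indices n : pairwise (fun a b => val a < val b) (indices n).
Proof.
rewrite pairwise_cat; apply/and3P; split.
- apply/allrelP => _ _ /mapP[i _ ->] /mapP[j _ ->] //.
- rewrite pairwise_map -sorted_pairwise ?rev_sorted; last first.
    by move=> a b c; apply: lt_trans.
  have := iota_ltn_sorted 0 n; apply: sub_sorted => i j /= ij.
  by rewrite /relpre /=; lia.
- rewrite pairwise_map; have := iota_ltn_sorted 0 n.
  rewrite (sorted_pairwise ltn_trans); apply: sub_pairwise => i j /= ij.
  by rewrite /relpre /=; lia.
Qed.

Definition psum_upto n k : R :=
  \sum_(j < n) alpha j ^+ k + (-1) ^+ k.+1 * \sum_(j < n) beta j ^+ k.

(** A positive letter multiplies the generating function by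
    [(1 - a * z) / (1 - q * a * z)] and a negative one by
    [(1 + q * a * z) / (1 + a * z)]; these factors produce the super-symmetric
    power sums. *)
Lemma chainF_indices n m : chainF weight Rdiag (indices n) m *+ m
  = convol (fun i => (\sum_(l < i.+1) q ^+ l) * psum_upto n i.+1)
      (withone (q - 1) (chainF weight Rdiag (indices n))) m.
Proof.
rewrite (@chainF_newton _ _ weight Rdiag (q - 1) _ (fun a b => val a < val b)).
- apply: eq_bigr => i _; congr (_ * _).
  have powers (a c c' : R) : a * \sum_(l < i.+1) (a * c) ^+ (i - l) * (a * c') ^+ l
      = a ^+ i.+1 * \sum_(l < i.+1) c ^+ (i - l) * c' ^+ l.
    rewrite exprS -mulrA; congr (_ * _); rewrite mulr_sumr; apply: eq_bigr => l _.
    have -> : a ^+ i = a ^+ (i - l) * a ^+ l by rewrite -exprD subnK // -ltnS.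
    by rewrite !exprMn; ring.
  rewrite big_indices addrC /psum_upto mulrDr.
  rewrite mulrCA !mulr_sumr; congr (_ + _); apply: eq_bigr => j _; rewrite powers.
    rewrite /weight /Rdiag eqxx /= mulrC; congr (_ * _).
    rewrite (reindex_inj rev_ord_inj) /=; apply: eq_bigr => l _.
    by rewrite subSS subKn -1?ltnS // subKr expr1n mulr1.
  rewrite /weight /Rdiag eqxx [LHS]/= [RHS]mulrA [RHS]mulrC; congr (_ * _).
  rewrite mulr_sumr; apply: eq_bigr => l _.
  have -> : - 1 - (q - 1) = -1 * q by ring.
  rewrite exprMn mulrA -exprD subnK -1?ltnS // !exprS; ring.
- move=> a b ab; rewrite /Rdiag; case: eqP => [e|_]; first by rewrite e ltxx in ab.
  by rewrite ltNge ltW.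
- move=> a b ab; rewrite /Rdiag; case: eqP => [e|_]; first by rewrite e ltxx in ab.
  by rewrite ab.
- exact: pairwise_indices.
Qed.

Hypotheses (cvg_alpha : forall k, (0 < k)%N -> cvgn (series (fun i => alpha i ^+ k)))
  (cvg_beta : forall k, (0 < k)%N -> cvgn (series (fun i => beta i ^+ k))).

Lemma cvg_psum_upto k : (0 < k)%N ->
  psum_upto n k @[n --> \oo] --> psum alpha beta k.
Proof.
move=> k0; apply: cvgD; last (apply: cvgM; first exact: cvg_cst).
  have := cvg_alpha k0; apply: cvg_trans.
  by apply: near_eq_cvg; near=> n; rewrite /series /= big_mkord.
have := cvg_beta k0; apply: cvg_trans.
by apply: near_eq_cvg; near=> n; rewrite /series /= big_mkord.
Unshelve. all: by end_near.
Qed.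

Lemma newton_at_limit (F : nat -> R) :
  (forall m, chainF weight Rdiag (indices n) m @[n --> \oo] --> F m) ->
  newton_at q F.
Proof.
move=> Fcvg m.
have cvgL : chainF weight Rdiag (indices n) m *+ m @[n --> \oo] --> F m *+ m.
  exact: cvgMn.
apply: (cvg_unique _ cvgL) => //=.
under eq_fun do rewrite chainF_indices /convol.
apply: cvg_bigsum => i; apply: cvgM.
  by apply: cvgM; [exact: cvg_cst | exact: cvg_psum_upto].
case: (m - i.+1)%N => [|k] /=; first exact: cvg_cst.
by apply: cvgM; [exact: cvg_cst | exact: Fcvg].
Qed.

End TruncatedSums.
End ZetaValues.

(** * Total families in Hilbert spaces *)

Section HilbertBasics.
Variable R : realType.
Implicit Types H E : hilbertType R.

Lemma innerC H (x y : H) : inner x y = Num.conj (inner y x).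
Proof. by rewrite hermC /= expr0 mul1r. Qed.

Lemma innerDl H (x y z : H) : inner (x + y) z = inner x z + inner y z.
Proof. exact: linearDl. Qed.

Lemma innerBl H (x y z : H) : inner (x - y) z = inner x z - inner y z.
Proof. exact: linearBl. Qed.

Lemma innerZl H a (x z : H) : inner (a *: x) z = a * inner x z.
Proof. exact: linearZl_LR. Qed.

Lemma inner0l H (z : H) : inner 0 z = 0.
Proof. exact: linear0l. Qed.

Lemma innerDr H (x y z : H) : inner z (x + y) = inner z x + inner z y.
Proof. by rewrite innerC innerDl rmorphD [inner z x]innerC [inner z y]innerC. Qed.

Lemma innerBr H (x y z : H) : inner z (x - y) = inner z x - inner z y.
Proof. by rewrite innerC innerBl rmorphB [inner z x]innerC [inner z y]innerC. Qed.

Lemma innerZr H a (x z : H) : inner z (a *: x) = Num.conj a * inner z x.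
Proof. by rewrite innerC innerZl rmorphM [inner z x]innerC. Qed.

Lemma inner0r H (z : H) : inner z 0 = 0.
Proof. by rewrite innerC inner0l rmorph0. Qed.

Lemma inner_suml H I (r : seq I) (f : I -> H) z :
  inner (\sum_(i <- r) f i) z = \sum_(i <- r) inner (f i) z.
Proof.
elim: r => [|i r IH]; first by rewrite !big_nil inner0l.
by rewrite !big_cons innerDl IH.
Qed.

Lemma inner_eq0 H (x : H) : (forall y, inner x y = 0) -> x = 0.
Proof.
move=> /(_ x) /eqP; rewrite inner_norm expf_eq0 /= normr_eq0 => /eqP ->//.
Qed.

Lemma cauchy_schwarz H (x y : H) : `|inner x y| <= `|x| * `|y|.
Proof.
have [->|y0] := eqVneq y 0; first by rewrite inner0r !normr0 mulr0.
have ny : 0 < `|y| ^+ 2 by rewrite exprn_gt0 // normr_gt0.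
pose a := inner x y / `|y| ^+ 2; pose u := x - a *: y.
have uy : inner u y = 0.
  by rewrite innerBl innerZl inner_norm divfK ?subrr // gt_eqF.
have : `|a| ^+ 2 * `|y| ^+ 2 <= `|x| ^+ 2.
  have ex : x = u + a *: y by rewrite subrK.
  move: (u) uy ex => {}u uy ex.
  have : inner x x = inner u u + a * Num.conj a * inner y y.
    rewrite ex innerDl !innerDr !innerZl !innerZr uy [inner y u]innerC uy.
    by rewrite rmorph0 !mulr0 addr0 add0r mulrA.
  by rewrite !inner_norm -normCK => ->; rewrite lerDr exprn_ge0.
rewrite -exprMn ler_pXn2r ?nnegrE ?mulr_ge0 // => le.
have -> : `|inner x y| = `|a| * `|y| * `|y|.
  by rewrite -mulrA -expr2 -[_ ^+ 2]ger0_norm ?ltW // -normrM /a divfK ?gt_eqF.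
exact: ler_wpM2r.
Qed.

Lemma cauchy_schwarz_eps H (x z : H) :
  (forall e : R[i], 0 < e -> exists2 y, `|x - y| < e & inner y z = 0) ->
  inner x z = 0.
Proof.
move=> h; apply/eqP/contraT; rewrite -normr_gt0 => nz.
have z0 : 0 < `|z| + 1 by rewrite ltr_wpDl.
have [y xy yz] := h _ (divr_gt0 nz z0).
have : `|inner x z| <= `|x - y| * `|z|.
  by have := cauchy_schwarz (x - y) z; rewrite innerBl yz subr0.
move=> /le_lt_trans -/(_ `|inner x z|).
suff lt : `|x - y| * `|z| < `|inner x z| by move=> /(_ lt); rewrite ltxx.
apply: le_lt_trans (_ : `|x - y| * (`|z| + 1) < _).
  by rewrite ler_wpM2l // lerDl.
by rewrite -ltr_pdivlMr.
Qed.

Lemma closure_eps H (A : set H) x :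
  closure A x <-> forall e : R[i], 0 < e -> exists2 y, A y & `|x - y| < e.
Proof.
split=> [clA e e0|h B /nbhs_ballP[e e0 eB]].
  have [y [Ay xy]] := clA _ (nbhsx_ballx x e e0).
  by exists y => //; move: xy; rewrite -ball_normE.
have [y Ay xy] := h e e0; exists y; split=> //; apply: eB.
by rewrite -ball_normE.
Qed.

(** Closedness is put in the metric form that the estimates below produce. *)
Definition closed_subspace H (P : set H) :=
  [/\ P 0, forall c x y, P x -> P y -> P (c *: x + y)
    & forall x, (forall e : R[i], 0 < e -> exists2 y, P y & `|x - y| < e) -> P x].

Lemma lspan_sub H (A P : set H) : closed_subspace P -> A `<=` P -> lspan A `<=` P.
Proof.
move=> [P0 Plin _] AP _ [n [c [a [Aa ->]]]].
elim: n c a Aa => [|n IH] c a Aa; first by rewrite big_ord0.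
rewrite big_ord_recl; apply: Plin; first exact/AP/Aa.
by apply: IH => i; apply: Aa.
Qed.

Lemma closed_lspan_sub H (A P : set H) :
  closed_subspace P -> A `<=` P -> closed_lspan A `<=` P.
Proof.
move=> cP AP x /closure_eps clx; have [_ _ Pcl] := cP; apply: Pcl => e /clx[y Ay xy].
by exists y => //; apply: lspan_sub Ay.
Qed.

Lemma total_ind H (A P : set H) : total_set A -> closed_subspace P ->
  A `<=` P -> forall x, P x.
Proof. by move=> totA cP AP x; apply: closed_lspan_sub AP _ _ => //; rewrite totA. Qed.

Lemma closed_lspan_subspace H (A : set H) : closed_subspace (closed_lspan A).
Proof.
have lin c x y : lspan A x -> lspan A y -> lspan A (c *: x + y).
  move=> [n [d [a [Aa ->]]]] [p [f [b [Ab ->]]]].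
  exists (n + p)%N, (fun i => match fintype.split i with inl j => c * d j | inr k => f k end),
    (fun i => match fintype.split i with inl j => a j | inr k => b k end); split.
    by move=> i; case: (fintype.split i).
  rewrite big_split_ord /= scaler_sumr; congr (_ + _); apply: eq_bigr => i _.
    by rewrite (unsplitK (inl i)) scalerA.
  by rewrite (unsplitK (inr i)).
split.
- apply/closure_eps => e e0; exists 0; last by rewrite subrr normr0.
  by exists 0%N, (fun=> 0), (fun=> 0); split; [case|rewrite big_ord0].
- move=> c x y /closure_eps clx /closure_eps cly; apply/closure_eps => e e0.
  have c0 : 0 < `|c| + 1 by rewrite ltr_wpDl.
  have e2 : 0 < e / 2 by rewrite divr_gt0.
  have [x' Ax' xx'] := clx _ (divr_gt0 e2 c0); have [y' Ay' yy'] := cly _ e2.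
  exists (c *: x' + y'); first exact: lin.
  rewrite opprD addrACA -scalerBr (splitr e); apply: le_lt_trans (ler_normD _ _) _.
  apply: ltrD => //; rewrite normrZ.
  apply: le_lt_trans (_ : (`|c| + 1) * `|x - x'| < _).
    by rewrite ler_wpM2r // lerDl.
  by rewrite -ltr_pdivlMl // mulrC.
- move=> x h; apply/closure_eps => e e0.
  have e2 : 0 < e / 2 by rewrite divr_gt0.
  have [y /closure_eps /(_ _ e2)[z Az yz] xy] := h _ e2.
  exists z => //; rewrite -(subrKA y) (splitr e).
  by apply: le_lt_trans (ler_normD _ _) _; apply: ltrD.
Qed.

Lemma closed_lspan_ge H (A : set H) : A `<=` closed_lspan A.
Proof.
move=> x Ax; apply/closure_eps => e e0; exists x; last by rewrite subrr normr0.
by exists 1%N, (fun=> 1), (fun=> x); split=> //; rewrite big_ord1 scale1r.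
Qed.

Lemma total_trans H (A B : set H) : total_set A -> A `<=` closed_lspan B -> total_set B.
Proof.
move=> totA AB; apply/seteqP; split=> // x _.
exact: (total_ind totA (closed_lspan_subspace B) AB).
Qed.

Lemma inner_eq0_subspace H (z : H) : closed_subspace [set x | inner x z = 0].
Proof.
split=> /=; first exact: inner0l.
  by move=> c x y xz yz; rewrite innerDl innerZl xz yz mulr0 addr0.
by move=> x h; apply: cauchy_schwarz_eps => e /h[y yz xy]; exists y.
Qed.

Lemma total_inner_ext H (A : set H) x y : total_set A ->
  (forall z, A z -> inner x z = inner y z) -> x = y.
Proof.
move=> totA xy; apply/eqP; rewrite -subr_eq0; apply/eqP; apply: inner_eq0 => z.
rewrite innerC; suff -> : inner z (x - y) = 0 by rewrite rmorph0.
move: z; apply: (total_ind totA (inner_eq0_subspace _)) => z /xy e /=.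
by rewrite innerC innerBl e subrr rmorph0.
Qed.

Lemma linear_unpack (V W : lmodType R[i]) (f : V -> W) : linear f ->
  [/\ f 0 = 0, {morph f : x y / x + y}, {morph f : x y / x - y}
    & forall c x, f (c *: x) = c *: f x].
Proof.
move=> lf.
have f0 : f 0 = 0.
  have := lf 1 0 0; rewrite !scale1r !addr0 => e.
  by apply: (addrI (f 0)); rewrite -e addr0.
have fZ c x : f (c *: x) = c *: f x by have := lf c x 0; rewrite !addr0 f0 addr0.
have fD : {morph f : x y / x + y} by move=> x y; have := lf 1 x y; rewrite !scale1r.
by split=> // x y; rewrite fD -scaleN1r fZ scaleN1r.
Qed.

Lemma linear_sum_fun (V W : lmodType R[i]) (f : V -> W) I (r : seq I) (F : I -> V) :
  linear f -> f (\sum_(i <- r) F i) = \sum_(i <- r) f (F i).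
Proof.
move=> /linear_unpack[f0 fD _ _]; elim: r => [|i r IH]; first by rewrite !big_nil.
by rewrite !big_cons fD IH.
Qed.

Lemma total_linear_ext H E (A : set H) (f g : H -> E) : total_set A ->
  linear f -> linear g -> continuous f -> continuous g ->
  (forall x, A x -> f x = g x) -> forall x, f x = g x.
Proof.
move=> totA lf lg cf cg; apply: (@total_ind H A [set x | f x = g x]) => //.
split=> /=.
- by have [-> _ _ _] := linear_unpack lf; have [-> _ _ _] := linear_unpack lg.
- by move=> c x y fx fy; rewrite lf lg fx fy.
- move=> x h; apply/eqP/contraT; rewrite -subr_eq0 -normr_gt0 => nz.
have n2 : 0 < `|f x - g x| / 2 by rewrite divr_gt0.
have /nbhs_ballP[e /= e0 fe] := @cf x _ (nbhsx_ballx (f x) _ n2).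
have /nbhs_ballP[e' /= e'0 ge] := @cg x _ (nbhsx_ballx (g x) _ n2).
(* A positive number below both radii that avoids comparing them, the order
   of [R[i]] being partial. *)
pose d := e * e' / (e + e').
have ee : 0 < e + e' by rewrite addr_gt0.
have d0 : 0 < d by rewrite !(divr_gt0, mulr_gt0).
have [y fgy xy] := h d d0.
have de : d < e.
  by rewrite /d ltr_pdivrMr // mulrDr ltrDr mulr_gt0.
have de' : d < e'.
  by rewrite /d ltr_pdivrMr // mulrDr [e * e']mulrC ltrDl mulr_gt0.
have := fe y; have := ge y; rewrite /= -!ball_normE /=.
move=> /(_ (lt_trans xy de')) gy /(_ (lt_trans xy de)) fy.
have : `|f x - g x| < `|f x - g x| / 2 + `|f x - g x| / 2.
  apply: le_lt_trans (ltrD fy gy); rewrite -[`|g x - _|]normrN opprB -fgy.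
  by rewrite -{1}(subrKA (f y)) ler_normD.
by rewrite -splitr ltxx.
Qed.

Lemma closed_subspace_preimage H E (f : H -> E) (C : R[i]) (P : set E) :
  linear f -> 0 <= C -> (forall x, `|f x| <= C * `|x|) ->
  closed_subspace P -> closed_subspace [set x | P (f x)].
Proof.
move=> lf C0 fC [P0 Plin Pcl]; have [f0 _ fB _] := linear_unpack lf.
split=> /=; first by rewrite f0.
  by move=> c x y Px Py; rewrite lf; apply: Plin.
move=> x h; apply: Pcl => e e0; have C1 : 0 < C + 1 by rewrite ltr_wpDl.
have [y Py xy] := h _ (divr_gt0 e0 C1); exists (f y) => //.
rewrite -fB; apply: le_lt_trans (fC _) _.
apply: le_lt_trans (_ : (C + 1) * `|x - y| < _).
  by rewrite ler_wpM2r // lerDl.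
by rewrite -ltr_pdivlMl // mulrC.
Qed.

Lemma lt0_real (e : R[i]) : 0 < e -> exists2 r : R, 0 < r & e = r%:C.
Proof.
move=> e0; have /complex_realP[r er] : e \is Num.real by rewrite gtr0_real.
by exists r; rewrite // -ltcR -er.
Qed.

Lemma norm_sum_orthonormal H (e : nat -> H) (c : nat -> R) (A : seq nat) :
  (forall i j, inner (e i) (e j) = (i == j)%:R) -> (forall i, 0 <= c i) -> uniq A ->
  `|\sum_(i <- A) (Num.sqrt (c i))%:C *: e i| ^+ 2 = (\sum_(i <- A) c i)%:C.
Proof.
move=> oe c0 uA; rewrite -inner_norm inner_suml rmorph_sum /=.
apply: eq_big_seq => i iA; rewrite innerZl innerC inner_suml (big_rem i) //=.
rewrite big_seq big1 => [|j].
  rewrite addr0 innerZl oe eqxx mulr1 conj_real_complex -rmorphM /=.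
  by rewrite -expr2 sqr_sqrtr.
by rewrite mem_rem_uniq // inE => /andP[/negPf ji _]; rewrite innerZl oe ji mulr0.
Qed.

(** By the Pythagorean theorem the tails of both series have the same size. *)
Lemma cvg_orthonormal_series H (e : nat -> H) (c : nat -> R) :
  (forall i j, inner (e i) (e j) = (i == j)%:R) -> (forall i, 0 <= c i) ->
  cvgn (series c) -> cvgn (series (fun j => (Num.sqrt (c j))%:C *: e j)).
Proof.
move=> oe c0 /cauchy_cvgP/cauchy_seriesP cc.
apply/cauchy_cvgP/cauchy_seriesP => _ /lt0_real[r r0 ->].
have := cc _ (exprn_gt0 2 r0); apply: filterS => -[m n] /= lt_r.
rewrite -(@ltr_pXn2r _ 2) ?nnegrE ?normr_ge0 ?ler0c ?(ltW r0) // (norm_sum_orthonormal oe c0) ?iota_uniq //.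
rewrite -rmorphXn /= ltcR; apply: le_lt_trans lt_r; exact: ler_norm.
Qed.

Lemma inner_lim H (u : nat -> H) l z s : u @ \oo --> l ->
  (\forall n \near \oo, inner (u n) z = s) -> inner l z = s.
Proof.
move=> ul us; apply/eqP; rewrite -subr_eq0; apply/contraT; rewrite -normr_gt0 => nz.
have z0 : 0 < `|z| + 1 by rewrite ltr_wpDl.
have /cvgrPdist_lt/(_ _ (divr_gt0 nz z0)) near_lt := ul.
have [n [/= lt_n en]] := filter_ex (filterI near_lt us).
rewrite -en ltr_pdivlMr // in lt_n; have := cauchy_schwarz (l - u n) z.
rewrite innerBl => /(lt_le_trans lt_n).
by rewrite mulrDr mulr1 gtrDl => /lt_geF; rewrite normr_ge0.
Qed.

End HilbertBasics.

(** * The matrix R and the slots of the infinite tensor product *)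

Section RMatrix.
Variables (R : realType) (q : R).

(** The coefficient of the exchange of two letters in [R]. *)
Definition Roff (a c : znz) : R := if a != c then - Num.sqrt q else 0.

Lemma RmatE (E : lmodType R[i]) (t : znz -> znz -> E) a c :
  Rmat q t a c = (Rdiag q a c)%:C *: t a c + (Roff a c)%:C *: t c a.
Proof.
rewrite /Rmat /Rdiag /Roff; case: (eqVneq a c) => [<-|ac] /=.
  rewrite ltxx !scaler0 !scale0r subr0 !addr0.
  have: val a != 0 by exact: valP a.
  case: ltgtP => // _ _; rewrite ?scaler0 ?addr0 ?oppr0 ?add0r //.
  by rewrite rmorphN scaleN1r.
rewrite oppr0 scaler0 !add0r addrC rmorphN scaleNr; congr (_ - _).
by case: ifP => _; rewrite ?scaler0 ?scale0r.
Qed.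

Lemma Rmat_linear (E E' : lmodType R[i]) (f : E -> E') t a c : linear f ->
  f (Rmat q t a c) = Rmat q (fun x y => f (t x y)) a c.
Proof. by move=> /linear_unpack[_ fD _ fZ]; rewrite !RmatE fD !fZ. Qed.

Lemma Rmat_exchange (E : lmodType R[i]) (t : znz -> znz -> znz -> znz -> E) a c b d :
  Rmat q (fun x y => Rmat q (t x y) b d) a c
  = Rmat q (fun x' y' => Rmat q (fun x y => t x y x' y') a c) b d.
Proof.
rewrite !RmatE !scalerDr !scalerA addrACA.
by congr (_ + _ + (_ + _)); rewrite mulrC.
Qed.

Lemma Roff_sym a c : Roff a c = Roff c a.
Proof. by rewrite /Roff eq_sym. Qed.

End RMatrix.

Lemma put_id (T : Type) (u : nat -> T) j : put u j (u j) = u.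
Proof. by apply/funext => n; rewrite /put; case: eqP => [->|]. Qed.

Lemma put_put (T : Type) (u : nat -> T) i j x y : i != j ->
  put (put u i x) j y = put (put u j y) i x.
Proof.
move=> ij; apply/funext => n; rewrite /put.
by case: (eqVneq n j) => // ->; rewrite eq_sym (negPf ij).
Qed.

Lemma eventually_put (T : Type) (xi : T) u j x :
  eventually_eq xi u -> eventually_eq xi (put u j x).
Proof.
move=> [N uN]; exists (maxn N j.+1) => n; rewrite geq_max => /andP[Nn jn].
by rewrite /put gtn_eqF // uN.
Qed.

Section InfiniteTensor.
Variables (R : realType) (U X : hilbertType R) (xi : U) (itens : (nat -> U) -> X).
Hypothesis itensP : is_infinite_tensor xi itens.

Lemma eventually_xi : eventually_eq xi (fun=> xi).
Proof. by exists 0%N. Qed.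

(** Comparing the two descriptions of the vacuum as a tensor of length 0 and 1. *)
Lemma inner_xi : inner xi xi = 1.
Proof.
have h N : forall n, (N <= n)%N -> (fun=> xi) n = xi /\ (fun=> xi) n = xi by [].
by have := itens_inner itensP (h 1%N); rewrite (itens_inner itensP (h 0%N)) big_ord0 big_ord1.
Qed.

Lemma slot_linear u j : eventually_eq xi u -> linear (fun x => itens (put u j x)).
Proof. by move=> ev c x y; apply: (itens_linear itensP). Qed.

(** The inner product of two elementary tensors factors through one slot; [xi],
    a unit vector, serves as the neutral filling. *)
Lemma slot_inner u u' j x x' : eventually_eq xi u -> eventually_eq xi u' ->
  inner (itens (put u j x)) (itens (put u' j x'))
  = inner x x' * inner (itens (put u j xi)) (itens (put u' j xi)).
Proof.
move=> [N uN] [N' u'N].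
have tail y y' n : (maxn (maxn N N') j.+1 <= n)%N ->
    put u j y n = xi /\ put u' j y' n = xi.
  rewrite !geq_max => /andP[/andP[Nn N'n] jn].
  by rewrite /put gtn_eqF // uN // u'N.
have jN : (j < maxn (maxn N N') j.+1)%N by rewrite leq_max ltnSn orbT.
rewrite (itens_inner itensP (tail x x')) (itens_inner itensP (tail xi xi)).
rewrite (bigD1 (Ordinal jN)) // [in RHS](bigD1 (Ordinal jN)) //=.
rewrite /put eqxx inner_xi mul1r; congr (_ * _); apply: eq_bigr => i.
by rewrite -val_eqE /= => /negPf ->.
Qed.

Lemma slot_norm u j x : eventually_eq xi u ->
  `|itens (put u j x)| = `|itens (put u j xi)| * `|x|.
Proof.
move=> ev; apply/eqP; rewrite -(@eqrXn2 _ 2) ?mulr_ge0 // exprMn -!inner_norm.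
by rewrite slot_inner // mulrC.
Qed.

Lemma pair_inner u u' j : eventually_eq xi u -> eventually_eq xi u' ->
  exists C, forall x y x' y',
    inner (itens (put2 u j x y)) (itens (put2 u' j x' y'))
    = inner x x' * inner y y' * C.
Proof.
move=> ev ev'; have jj : j != j.+1 by rewrite neq_ltn ltnSn.
exists (inner (itens (put2 u j xi xi)) (itens (put2 u' j xi xi))) => x y x' y'.
rewrite /put2 slot_inner; try exact: eventually_put.
rewrite ![put (put _ j _) j.+1 _]put_put // slot_inner; try exact: eventually_put.
by rewrite mulrA [inner y y' * _]mulrC.
Qed.

Section Level.
Variable e : znz -> znz -> U.
Hypothesis e_total : total_set [set e p.1 p.2 | p in [set: znz * znz]].

(** Basis vectors in the first [M] slots, other vectors afterwards: unlike the
    tensors filled with [xi] from slot [M] on, these are total for fixed [M]. *)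
Definition comb (a b : nat -> znz) (u : nat -> U) (M : nat) : nat -> U :=
  fun n => if (n < M)%N then e (a n) (b n) else u n.

Lemma eventually_comb a b u M : eventually_eq xi u -> eventually_eq xi (comb a b u M).
Proof.
move=> [N uN]; exists (maxn N M) => n; rewrite geq_max => /andP[Nn Mn].
by rewrite /comb ltnNge Mn /= uN.
Qed.

Definition level (M : nat) : set X :=
  [set z | exists a b u, eventually_eq xi u /\ z = itens (comb a b u M)].

Lemma put_comb a b u M i x y : (i < M)%N ->
  put (comb a b u M) i (e x y) = comb (put a i x) (put b i y) u M.
Proof.
move=> iM; apply/funext => n; rewrite /put /comb.
by case: (eqVneq n i) => [->|//]; rewrite iM.
Qed.

Lemma level_total M : total_set (level M).
Proof.
elim: M => [|M IH].
  apply: (total_trans (itens_total itensP)) => _ [u ev <-].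
  apply: closed_lspan_ge; exists (fun=> zpos 0), (fun=> zpos 0), u; by split.
apply: (total_trans IH) => _ [a [b [u [ev ->]]]].
have evc : eventually_eq xi (comb a b u M) by apply: eventually_comb.
rewrite -(put_id (comb a b u M) M); move: (comb a b u M M).
apply: (total_ind e_total).
  apply: (closed_subspace_preimage (C := `|itens (put (comb a b u M) M xi)|)) => //.
  - exact: slot_linear.
  - by move=> x; rewrite slot_norm.
  - exact: closed_lspan_subspace.
move=> _ [[x y] _ <-] /=; apply: closed_lspan_ge.
exists (put a M x), (put b M y), u; split=> //; congr (itens _); apply/funext => n.
by rewrite /put /comb ltnS; case: ltngtP.
Qed.

Definition pairs (j : nat) : set X :=
  [set z | exists u a b c d, eventually_eq xi u /\
    z = itens (put2 u j (e a b) (e c d))].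

Lemma pairs_total j : total_set (pairs j).
Proof.
apply: (total_trans (level_total j.+2)) => _ [a [b [u [ev ->]]]].
apply: closed_lspan_ge.
exists (comb a b u j.+2), (a j), (b j), (a j.+1), (b j.+1); split.
  exact: eventually_comb.
congr (itens _); rewrite /put2 !put_comb //; congr (comb _ _ _ _).
  by rewrite put_id put_id.
by rewrite put_id put_id.
Qed.

End Level.
End InfiniteTensor.

(** * The left and right actions of R *)

Lemma adjoint_subspace (R : realType) (X : hilbertType R) (T : X -> X) y z :
  linear T -> continuous T -> closed_subspace [set x | inner (T x) y = inner x z].
Proof.
move=> lT cT; have [T0 _ TB _] := linear_unpack lT; split=> /=.
- by rewrite T0 !inner0l.
- by move=> c x x' ex ex'; rewrite lT !innerDl !innerZl ex ex'.
move=> x h; apply/eqP; rewrite -subr_eq0; apply/contraT; rewrite -normr_gt0 => nz.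
have yz0 : 0 < `|y| + `|z| + 1 by rewrite ltr_wpDl // addr_ge0.
set d := `|_| in nz; pose m := d / (`|y| + `|z| + 1).
have m0 : 0 < m by rewrite divr_gt0.
have /nbhs_ballP[r /= r0 Tr] := @cT x _ (nbhsx_ballx (T x) _ m0).
(* A positive number below both radii that avoids comparing them, the order
   of [R[i]] being partial. *)
pose s := r * m / (r + m).
have rm : 0 < r + m by rewrite addr_gt0.
have s0 : 0 < s by rewrite !(divr_gt0, mulr_gt0).
have [x' ex' xx'] := h s s0.
have sr : s < r by rewrite /s ltr_pdivrMr // mulrDr ltrDr mulr_gt0.
have sm : s < m by rewrite /s ltr_pdivrMr // mulrDr [r * m]mulrC ltrDl mulr_gt0.
have := Tr x'; rewrite /= -!ball_normE /= => /(_ (lt_trans xx' sr)) Txx'.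
have : d <= `|T x - T x'| * `|y| + `|x - x'| * `|z|.
  apply: le_trans (lerD (cauchy_schwarz _ _) (cauchy_schwarz _ _)).
  apply: le_trans (ler_normB _ _); rewrite !innerBl ex' /d.
  by rewrite opprB addrA subrK.
have : `|T x - T x'| * `|y| + `|x - x'| * `|z| <= m * (`|y| + `|z|).
  by rewrite mulrDr lerD // ler_wpM2r // ltW // (lt_trans xx').
move=> le1 le2; have := le_trans le2 le1.
have -> : m * (`|y| + `|z|) = d - m.
  by rewrite -[`|y| + `|z|](addrK 1) mulrBr mulr1 /m divfK // gt_eqF.
by rewrite -subr_ge0 addrAC subrr add0r oppr_ge0 => /le_gtF; rewrite m0.
Qed.

Section Actions.
Variables (R : realType) (q : R) (U X : hilbertType R) (xi : U).
Variable itens : (nat -> U) -> X.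
Hypothesis itensP : is_infinite_tensor xi itens.

(** With [e a b] the tensor of [v a] and [w b] this is the left action; exchanging
    the arguments of [e] gives the right action, so both are treated at once. *)
Definition acts (e : znz -> znz -> U) (j : nat) (T : X -> X) :=
  forall u, eventually_eq xi u -> forall a b c d,
    T (itens (put2 u j (e a b) (e c d)))
    = Rmat q (fun a' c' => itens (put2 u j (e a' b) (e c' d))) a c.

Definition orthonormal2 (e : znz -> znz -> U) :=
  forall a b a' b', inner (e a b) (e a' b') = (a == a')%:R * (b == b')%:R.

Lemma flip_orthonormal e : orthonormal2 e -> orthonormal2 (fun b a => e a b).
Proof. by move=> oe a b a' b'; rewrite oe mulrC. Qed.

Lemma flip_total (e : znz -> znz -> U) :
  total_set [set e p.1 p.2 | p in [set: znz * znz]] ->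
  total_set [set e p.2 p.1 | p in [set: znz * znz]].
Proof.
suff -> : [set e p.2 p.1 | p in [set: znz * znz]]
        = [set e p.1 p.2 | p in [set: znz * znz]] by [].
by apply/seteqP; split=> _ [[x y] _ <-]; exists (y, x).
Qed.

Lemma acts_inner e j T u z a b c d : acts e j T -> eventually_eq xi u ->
  inner (T (itens (put2 u j (e a b) (e c d)))) z
  = (Rdiag q a c)%:C * inner (itens (put2 u j (e a b) (e c d))) z
    + (Roff q a c)%:C * inner (itens (put2 u j (e c b) (e a d))) z.
Proof. by move=> aT ev; rewrite aT // RmatE innerDl !innerZl. Qed.

Lemma acts_innerr e j T u z a b c d : acts e j T -> eventually_eq xi u ->
  inner z (T (itens (put2 u j (e a b) (e c d))))
  = (Rdiag q a c)%:C * inner z (itens (put2 u j (e a b) (e c d)))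
    + (Roff q a c)%:C * inner z (itens (put2 u j (e c b) (e a d))).
Proof.
by move=> aT ev; rewrite aT // RmatE innerDr !innerZr !conj_real_complex.
Qed.

(** The matrix [R] is real and symmetric. *)
Lemma acts_selfadjoint e j T : orthonormal2 e ->
  total_set [set e p.1 p.2 | p in [set: znz * znz]] ->
  linear T -> continuous T -> acts e j T ->
  forall x y, inner (T x) y = inner x (T y).
Proof.
move=> oe te lT cT aT.
have tp := pairs_total itensP te j.
have sym x y : pairs xi itens e j x -> pairs xi itens e j y ->
    inner (T x) y = inner x (T y).
  move=> [u [a [b [c [d [ev ->]]]]]] [u' [a' [b' [c' [d' [ev' ->]]]]]].
  rewrite (acts_inner _ _ _ _ _ aT ev) (acts_innerr _ _ _ _ _ aT ev').
  have [C eC] := pair_inner itensP j ev ev'.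
  rewrite !eC !oe; congr (_ + _).
    case: (eqVneq a a') => [<-|_]; last by rewrite !mul0r !mulr0.
    by case: (eqVneq c c') => [<-|_] //; rewrite !mul0r !mulr0 !mul0r !mulr0.
  case: (eqVneq a c') => [<-|_]; last by rewrite !mul0r !mulr0 !mul0r !mulr0.
  case: (eqVneq c a') => [<-|_]; last by rewrite !mul0r !mulr0 !mul0r !mulr0.
  by rewrite Roff_sym.
have symr y : pairs xi itens e j y -> forall x, inner (T x) y = inner x (T y).
  move=> py; apply: (total_ind tp (adjoint_subspace _ _ lT cT)) => x px.
  exact: sym.
move=> x y; rewrite [LHS]innerC [RHS]innerC; congr (Num.conj _); symmetry.
move: y; apply: (total_ind tp (adjoint_subspace _ _ lT cT)) => y py /=.
by rewrite [LHS]innerC [RHS]innerC symr.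
Qed.

Lemma acts_comb e j T a b u M : acts e j T -> eventually_eq xi u -> (j.+1 < M)%N ->
  T (itens (comb e a b u M))
  = Rmat q (fun x y => itens (comb e (put (put a j x) j.+1 y) b u M)) (a j) (a j.+1).
Proof.
move=> aT ev jM; have jM' := ltnW jM.
have ec x y : put2 (comb e a b u M) j (e x (b j)) (e y (b j.+1))
    = comb e (put (put a j x) j.+1 y) b u M.
  rewrite /put2 !put_comb //; congr (comb _ _ _ _ _).
  by rewrite put_id put_id.
have := ec (a j) (a j.+1); rewrite put_id put_id => {1}<-.
by rewrite aT ?RmatE ?ec //; exact: eventually_comb.
Qed.

(** The two actions change different indices of a basis vector. *)
Lemma acts_commute e i j T T' :
  total_set [set e p.1 p.2 | p in [set: znz * znz]] ->
  linear T -> continuous T -> acts e i T ->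
  linear T' -> continuous T' -> acts (fun b a => e a b) j T' ->
  forall x, T (T' x) = T' (T x).
Proof.
move=> te lT cT aT lT' cT' aT'; pose M := (maxn i j).+2.
apply: (total_linear_ext (level_total itensP te M)).
- by move=> c x y; rewrite lT' lT.
- by move=> c x y; rewrite lT lT'.
- by move=> x; apply: continuous_comp; [exact: cT'|exact: cT].
- by move=> x; apply: continuous_comp; [exact: cT|exact: cT'].
move=> _ [a [b [u [ev ->]]]].
have iM : (i.+1 < M)%N by rewrite /M; lia.
have jM : (j.+1 < M)%N by rewrite /M; lia.
have flip a0 b0 : comb e a0 b0 u M = comb (fun b a => e a b) b0 a0 u M.
  by apply/funext.
rewrite (acts_comb _ _ aT) // (Rmat_linear _ _ _ _ lT').
under [in RHS]eq_fun2 do rewrite flip (acts_comb _ _ aT') // .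
rewrite Rmat_exchange [in LHS]flip (acts_comb _ _ aT') // (Rmat_linear _ _ _ _ lT).
by under [in LHS]eq_fun2 do rewrite -flip (acts_comb _ _ aT) // .
Qed.

(** Paired with a basis tensor, either side vanishes unless the left and right
    indices agree up to the exchange, because [xi] is diagonal; in the remaining
    cases the symmetry of [R] gives equality. *)
Lemma acts_vacuum e (s : znz -> R) j T T' :
  orthonormal2 e -> total_set [set e p.1 p.2 | p in [set: znz * znz]] ->
  (forall a b, inner xi (e a b) = (a == b)%:R * (s a)%:C) ->
  linear T -> continuous T -> acts e j T ->
  linear T' -> continuous T' -> acts (fun b a => e a b) j T' ->
  T (itens (fun=> xi)) = T' (itens (fun=> xi)).
Proof.
move=> oe te xis lT cT aT lT' cT' aT'.
have Tsym := acts_selfadjoint oe te lT cT aT.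
have T'sym := acts_selfadjoint (flip_orthonormal oe) (flip_total te) lT' cT' aT'.
apply: (total_inner_ext (pairs_total itensP te j)) => _ [u [a [b [c [d [ev ->]]]]]].
rewrite Tsym T'sym (acts_innerr _ _ _ _ _ aT ev) (acts_innerr _ _ _ _ _ aT' ev).
have -> : (fun=> xi) = put2 (fun=> xi) j xi xi by rewrite /put2 !put_id.
have [C eC] := pair_inner itensP j (eventually_xi xi) ev.
rewrite !eC !xis; congr (_ + _).
  case: (eqVneq a b) => [<-|_]; last by rewrite !mul0r !mulr0.
  by case: (eqVneq c d) => [<-|_] //; rewrite !mul0r !mulr0 !mul0r !mulr0.
case: (eqVneq a d) => [<-|_]; last by rewrite !mul0r !mulr0 !mul0r !mulr0.
case: (eqVneq c b) => [<-|_]; last by rewrite !mul0r !mulr0 !mul0r !mulr0.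
by rewrite Roff_sym !mul1r [X in _ * (X * _)]mulrC.
Qed.

End Actions.

(** * The trace property and isometric extension *)

Section TwoSidedAction.
Variables (R : realType) (q : R) (X : hilbertType R).
Variables (l r : hecke q -> X -> X) (Xi : X).
Hypotheses (lP : is_hilbert_rep l) (rP : is_hilbert_rep r).
Hypothesis lsym : forall j x y, inner (l (sigma j) x) y = inner x (l (sigma j) y).
Hypothesis rsym : forall j x y, inner (r (sigma j) x) y = inner x (r (sigma j) y).
Hypothesis lr_sigma : forall i j x,
  l (sigma i) (r (sigma j) x) = r (sigma j) (l (sigma i) x).
Hypothesis vacuum : forall j, r (sigma j) Xi = l (sigma j) Xi.

Lemma rep_linear_alg (p : hecke q -> X -> X) x : is_hilbert_rep p ->
  linear (fun A => p A x).
Proof. by move=> pP c A B; apply: (rep_linear_l pP). Qed.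

Lemma rep_add (p : hecke q -> X -> X) A B x : is_hilbert_rep p ->
  p (A + B) x = p A x + p B x.
Proof. by move=> pP; have [_ pD _ _] := linear_unpack (rep_linear_alg x pP); apply: pD. Qed.

Lemma rep_scale (p : hecke q -> X -> X) a A x : is_hilbert_rep p ->
  p (a *: A) x = a *: p A x.
Proof. by move=> pP; have [_ _ _ pZ] := linear_unpack (rep_linear_alg x pP); apply: pZ. Qed.

Lemma hstar_scal a : hstar (a%:A : hecke q) = (Num.conj a)%:A.
Proof.
by rewrite -[a%:A]hclass_const hstarE /= hclass_const.
Qed.

Lemma htransp_scal a : htransp (a%:A : hecke q) = a%:A.
Proof. by rewrite -[a%:A]hclass_const htranspE. Qed.

Lemma l_star A x y : inner (l (hstar A) x) y = inner x (l A y).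
Proof.
elim/hecke_gen_ind: A x y => [m|a|A B IHA IHB|A B IHA IHB] x y.
- by rewrite hstar_sigma lsym.
- by rewrite hstar_scal !(rep_scale _ _ _ lP) !(rep_one lP) innerZl innerZr.
- by rewrite hstarD !(rep_add _ _ _ lP) innerDl innerDr IHA IHB.
- by rewrite hstarM !(rep_mul lP) IHB IHA.
Qed.

Lemma lr_commute A B x : l A (r B x) = r B (l A x).
Proof.
have lin C := linear_unpack (rep_linear lP C).
have rlin C := linear_unpack (rep_linear rP C).
elim/hecke_gen_ind: A x => [i|a|A A' IHA IHA'|A A' IHA IHA'] x.
- elim/hecke_gen_ind: B x => [j|b|B B' IHB IHB'|B B' IHB IHB'] x.
  + exact: lr_sigma.
  + rewrite !(rep_scale _ _ _ rP) !(rep_one rP).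
    by have [_ _ _ ->] := lin (sigma i).
  + rewrite !(rep_add _ _ _ rP).
    by have [_ -> _ _] := lin (sigma i); rewrite IHB IHB'.
  + by rewrite !(rep_mul rP) IHB IHB'.
- rewrite !(rep_scale _ _ _ lP) !(rep_one lP).
  by have [_ _ _ ->] := rlin B.
- rewrite !(rep_add _ _ _ lP).
  by have [_ -> _ _] := rlin B; rewrite IHA IHA'.
- by rewrite !(rep_mul lP) IHA' IHA.
Qed.

Lemma r_vacuum B : r B Xi = l (htransp B) Xi.
Proof.
elim/hecke_gen_ind: B => [m|a|A B IHA IHB|A B IHA IHB].
- by rewrite htransp_sigma vacuum.
- by rewrite htransp_scal (rep_scale _ _ _ lP) (rep_scale _ _ _ rP) (rep_one lP) (rep_one rP).
- by rewrite htranspD (rep_add _ _ _ lP) (rep_add _ _ _ rP) IHA IHB.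
- by rewrite htranspM (rep_mul rP) IHB -lr_commute IHA -(rep_mul lP).
Qed.

(** A generator can be moved from right to left by letting it act on the
    vacuum from the other side. *)
Lemma vacuum_tracial A B : inner (l (A * B) Xi) Xi = inner (l (B * A) Xi) Xi.
Proof.
elim/hecke_gen_ind: B A => [m|a|B C IHB IHC|B C IHB IHC] A.
- rewrite !(rep_mul lP) -vacuum lr_commute rsym vacuum -lsym.
  by [].
- by rewrite -scalerAr mulr1 -scalerAl mul1r.
- by rewrite mulrDl mulrDr !(rep_add _ _ _ lP) !innerDl IHB IHC.
- by rewrite mulrA IHC mulrA IHB mulrA.
Qed.

End TwoSidedAction.

(** The images under [g] of the approximations of [x] form a Cauchy filter. With
    [f] dense this extends [g]; with [g] the identity and [f] an isometry it
    shows that the range of [f] is closed. *)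
Lemma isometric_limit (R : realType) (A : Type) (K X : hilbertType R)
    (f : A -> K) (g : A -> X) x :
  (forall a b, `|g a - g b| = `|f a - f b|) ->
  (forall e : R[i], 0 < e -> exists a, `|x - f a| < e) ->
  exists y, forall e : R[i], 0 < e -> exists2 a, `|x - f a| < e & `|y - g a| < e.
Proof.
move=> fg approx.
pose F : set_system X := fun B =>
  exists2 d : R[i], 0 < d & forall a, `|x - f a| < d -> B (g a).
have FF : ProperFilter F.
  apply: Build_ProperFilter_ex => [B [d d0 dB]|].
    by have [a xa] := approx _ d0; exists (g a); apply: dB.
  split.
  - by exists 1.
  - move=> B B' [d d0 dB] [d' d'0 dB'].
    have /lt0_real[s s0 es] := d0; have /lt0_real[s' s'0 es'] := d'0.
    exists (Num.min s s')%:C; first by rewrite ltcR lt_min s0.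
    move=> a xa; split; [apply: dB|apply: dB']; apply: lt_le_trans xa _;
    by rewrite ?es ?es' lecR ge_min lexx ?orbT.
  - by move=> B B' BB' [d d0 dB]; exists d => // a /dB /BB'.
have cF : cauchy F.
  apply: cauchy_exP => e e0; have e2 : 0 < e / 2 by rewrite divr_gt0.
  have [a0 xa0] := approx _ e2; exists (g a0), (e / 2) => // a xa.
  rewrite -ball_normE /= fg -(subrKA x) (splitr e); apply: le_lt_trans (ler_normD _ _) _.
  by apply: ltrD => //; rewrite distrC.
have /cvg_ex[y Fy] : cvg F by apply/cauchy_cvgP.
exists y => e e0.
have [d d0 dB] := Fy _ (nbhsx_ballx y e e0).
have /lt0_real[s s0 es] := d0; have /lt0_real[t t0 et] := e0.
have [|a xa] := approx (Num.min s t)%:C; first by rewrite ltcR lt_min s0.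
exists a; first by apply: lt_le_trans xa _; rewrite et lecR ge_min lexx orbT.
have := dB a; rewrite -ball_normE /=; apply; apply: lt_le_trans xa _.
by rewrite es lecR ge_min lexx.
Qed.

Lemma inner_limit (R : realType) (A : Type) (K X : hilbertType R)
    (f : A -> K) (g : A -> X) x y t z :
  (forall e : R[i], 0 < e -> exists2 a, `|x - f a| < e & `|y - g a| < e) ->
  (forall a, inner (g a) z = inner (f a) t) -> inner y z = inner x t.
Proof.
move=> h fg; apply/eqP; rewrite -subr_eq0; apply/contraT; rewrite -normr_gt0 => nz.
have zt0 : 0 < `|z| + `|t| + 1 by rewrite ltr_wpDl // addr_ge0.
set d := `|_| in nz; pose m := d / (`|z| + `|t| + 1).
have m0 : 0 < m by rewrite divr_gt0.
have [a xa ya] := h m m0.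
have : d <= `|y - g a| * `|z| + `|x - f a| * `|t|.
  apply: le_trans (lerD (cauchy_schwarz _ _) (cauchy_schwarz _ _)).
  apply: le_trans (ler_normB _ _); rewrite !innerBl fg /d.
  by rewrite opprB addrA subrK.
have : `|y - g a| * `|z| + `|x - f a| * `|t| <= m * (`|z| + `|t|).
  by rewrite mulrDr lerD // ler_wpM2r // ltW.
move=> le1 le2; have := le_trans le2 le1.
have -> : m * (`|z| + `|t|) = d - m.
  by rewrite -[`|z| + `|t|](addrK 1) mulrBr mulr1 /m divfK // gt_eqF.
by rewrite -subr_ge0 addrAC subrr add0r oppr_ge0 => /le_gtF; rewrite m0.
Qed.

Section IsometricExtension.
Variables (R : realType) (A : lmodType R[i]) (K X : hilbertType R).
Variables (f : {linear A -> K}) (g : A -> X).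
Hypotheses (lg : linear g) (f_dense : closure (range f) = setT).
Hypothesis fg : forall a b, inner (g a) (g b) = inner (f a) (f b).

(** Linearity of the extension follows from the preservation of inner products:
    the defect of linearity is orthogonal to the range, to whose span it
    belongs. *)
Lemma isometric_extension : exists T : {linear K -> X},
  (forall x y, inner (T x) (T y) = inner x y) /\ (forall a, T (f a) = g a).
Proof.
have norm_fg a b : `|g a - g b| = `|f a - f b|.
  have [_ _ gB _] := linear_unpack lg.
  by apply/eqP; rewrite -(@eqrXn2 _ 2) // -!inner_norm -gB -linearB fg.
have lim x := isometric_limit norm_fg (x := x).
have ex x : exists y, forall e : R[i], 0 < e ->
    exists2 a, `|x - f a| < e & `|y - g a| < e.
  apply: lim => e e0; have : closure (range f) x by rewrite f_dense.
  by move=> /closure_eps/(_ e e0)[_ [a _ <-] xa]; exists a.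
have [T TP] := choice ex.
have Tg x a : inner (T x) (g a) = inner x (f a).
  by apply: (inner_limit (TP x)) => b; rewrite fg.
have TT x y : inner (T x) (T y) = inner x y.
  by apply: (inner_limit (TP x)) => b; rewrite innerC Tg -innerC.
have lT : linear T.
  move=> c x y; apply/eqP; rewrite -subr_eq0 -normr_eq0 -sqrf_eq0 -inner_norm.
  have z w : inner (T (c *: x + y) - (c *: T x + T y)) (T w) = 0.
    by rewrite innerBl !innerDl !innerZl !TT !innerDl !innerZl subrr.
  by rewrite [X in _ == X]/= innerBr innerDr innerZr !z mulr0 addr0 subrr.
pose T' : {linear K -> X} := HB.pack T (GRing.isLinear.Build _ _ _ _ T lT).
exists T'; split=> // a; apply/eqP; rewrite -subr_eq0 -normr_eq0 -sqrf_eq0 -inner_norm.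
rewrite /= innerBl !innerBr TT Tg [inner (g a) (T _)]innerC Tg -innerC fg.
by rewrite !subrr.
Qed.

End IsometricExtension.

Lemma isometry_range_subspace (R : realType) (K X : hilbertType R)
    (T : {linear K -> X}) :
  (forall x y, inner (T x) (T y) = inner x y) -> closed_subspace (range T).
Proof.
move=> TT.
have normT x y : `|x - y| = `|T x - T y|.
  by apply/eqP; rewrite -(@eqrXn2 _ 2) // -!inner_norm -linearB TT.
split.
- by exists 0; rewrite ?linear0.
- by move=> c _ _ [x _ <-] [y _ <-]; exists (c *: x + y); rewrite ?linearP.
move=> x h; have [e e0|y yP] := isometric_limit normT (x := x).
  by have [_ [a _ <-] xa] := h e e0; exists a.
exists y => //; apply/eqP; rewrite eq_sym -subr_eq0; apply/contraT.
rewrite -normr_gt0 => nz; have n2 : 0 < `|x - T y| / 2 by rewrite divr_gt0.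
have [a xa ya] := yP _ n2; move: xa; rewrite normT in ya => xa.
suff : `|x - T y| < `|x - T y| by rewrite ltxx.
rewrite {2}(splitr `|x - T y|) -{1}(subrKA (T a)).
by apply: le_lt_trans (ler_normD _ _) _; apply: ltrD => //; rewrite distrC.
Qed.

(** * Vacuum expectation of words *)

Lemma rmorph_limit (R : realType) (z : R[i]) (c : nat -> R) :
  (forall e : R[i], 0 < e -> \forall n \near \oo, `|z - (c n)%:C| < e) ->
  z = (complex.Re z)%:C /\ c @ \oo --> complex.Re z.
Proof.
move=> zc; split.
  case: z zc => x y zc; apply/eqP; rewrite eq_complex /= eqxx /=.
  apply/contraT => y0; have y1 : 0 < `|y|%:C by rewrite ltcR normr_gt0.
  have [n lt_n] := filter_ex (zc _ y1); move: lt_n.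
  rewrite normc_def ltcR /= subr0 => lt_n.
  suff : `|y| < `|y| by rewrite ltxx.
  apply: le_lt_trans lt_n; rewrite -sqrtr_sqr ler_sqrt.
    by rewrite lerDr sqr_ge0.
  by rewrite addr_ge0 ?sqr_ge0.
apply/cvgrPdist_lt => e e0; have e0' : 0 < e%:C :> R[i] by rewrite ltcR.
near=> n; have : `|z - (c n)%:C| < e%:C by near: n; apply: zc.
move=> lt_n; rewrite -ltcR; apply: le_lt_trans lt_n.
have -> : complex.Re z - c n = complex.Re (z - (c n)%:C) by case: (z).
exact: normc_ge_Re.
Unshelve. all: by end_near.
Qed.

(** A word is evaluated by replacing [xi], in the slots that the word touches,
    by its finite partial sums. *)
Section MatrixCoefficients.
Variables (R : realType) (q : R) (U X : hilbertType R) (xi : U).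
Variable itens : (nat -> U) -> X.
Hypothesis itensP : is_infinite_tensor xi itens.
Variables (e : znz -> znz -> U) (p : znz -> R).
Hypothesis p_ge0 : forall a, 0 <= p a.
Hypothesis xi_e : forall a b, inner xi (e a b) = (a == b)%:R * (Num.sqrt (p a))%:C.
Variable l : hecke q -> X -> X.
Hypothesis lP : is_hilbert_rep l.
Hypothesis l_sigma : forall j, acts q xi itens e j (l (sigma j)).
Hypothesis lsym : forall j x y, inner (l (sigma j) x) y = inner x (l (sigma j) y).
Local Notation Xi := (itens (fun=> xi)).

Definition diag_vector (S : seq znz) : U := \sum_(a <- S) (Num.sqrt (p a))%:C *: e a a.

Definition truncated (S : seq znz) (K : nat) : nat -> U :=
  fun n => if (n < K)%N then diag_vector S else xi.

Lemma eventually_truncated S K : eventually_eq xi (truncated S K).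
Proof. by exists K => n; rewrite /truncated ltnNge => ->. Qed.

Lemma expand_truncated S K a b M : (M < K)%N ->
  itens (comb e a b (truncated S K) M) = \sum_(c <- S) (Num.sqrt (p c))%:C *:
    itens (comb e (put a M c) (put b M c) (truncated S K) M.+1).
Proof.
move=> MK; set u := comb e a b _ M.
have ev : eventually_eq xi u by apply/eventually_comb/eventually_truncated.
rewrite -(put_id u M) {2}/u /comb ltnn /truncated MK /diag_vector.
rewrite (linear_sum_fun _ _ (slot_linear itensP M ev)); apply: eq_bigr => c _.
have [_ _ _ ->] := linear_unpack (slot_linear itensP M ev).
congr (_ *: itens _); apply/funext => n.
by rewrite /u /put /comb ltnS; case: (ltngtP n M).
Qed.

Lemma inner_comb_vacuum a b S M :
  inner (itens (comb e a b (truncated S M) M)) Xi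
  = \prod_(i < M) ((a i == b i)%:R * (Num.sqrt (p (a i)))%:C).
Proof.
rewrite (itens_inner itensP (N := M)) => [|n Mn]; last first.
  by rewrite /comb /truncated ltnNge Mn.
apply: eq_bigr => i _; rewrite /comb ltn_ord innerC xi_e rmorphM rmorph_nat.
by rewrite /= conj_real_complex.
Qed.

Lemma l_sigma_comb j a b S K M : (j.+1 < M)%N ->
  l (sigma j) (itens (comb e a b (truncated S K) M))
  = (Rdiag q (a j) (a j.+1))%:C *: itens (comb e a b (truncated S K) M)
  + (Roff q (a j) (a j.+1))%:C *:
      itens (comb e (put (put a j (a j.+1)) j.+1 (a j)) b (truncated S K) M).
Proof.
move=> jM; rewrite (acts_comb _ _ (l_sigma j)) ?RmatE //; last exact: eventually_truncated.
by rewrite !put_id.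
Qed.

Lemma word_cons_vector j b bs x :
  l (word _ j (b :: bs)) x
  = l (word _ j.+1 bs) (if b then l (sigma j) x else x).
Proof. by rewrite /= (rep_mul lP); case: b => //; rewrite (rep_one lP). Qed.

(** The left action does not touch the right indices, and the pairing with the
    vacuum requires both indices of each slot to agree; a slot where they differ
    and which the rest of the word does not touch makes the pairing vanish. *)
Lemma word_offdiag S bs j i a b : (i < j)%N -> a i != b i ->
  inner (l (word _ j bs) (itens (comb e a b (truncated S (j.+1 + size bs)) j.+1))) Xi = 0.
Proof.
elim: bs j a b => [|c bs IH] j a b ij ab.
  rewrite (rep_one lP) addn0 inner_comb_vacuum.
  have ij1 : (i < j.+1)%N by rewrite ltnW.
  by rewrite (bigD1 (Ordinal ij1)) //= (negPf ab) !mul0r.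
rewrite word_cons_vector /= expand_truncated ?addnS ?ltnS ?leq_addr // -addSn.
have lw x := linear_unpack (rep_linear lP x).
have ij1 : (i < j.+1)%N by rewrite ltnW.
have neq_put x y : put a j.+1 x i != put b j.+1 y i.
  by rewrite /put !ltn_eqF.
have neq_put' t x y : put (put (put a j.+1 x) j t) j.+1 y i != put b j.+1 x i.
  by rewrite /put !ltn_eqF.
case: c => /=.
  rewrite (linear_sum_fun _ _ (rep_linear lP _)) (linear_sum_fun _ _ (rep_linear lP _)).
  rewrite inner_suml big1 // => c _.
  have [_ _ _ ->] := lw (sigma j); have [_ wD _ wZ] := lw (word _ j.+1 bs).
  rewrite l_sigma_comb // wZ wD !wZ innerZl innerDl !innerZl.
  by rewrite (IH _ _ _ ij1 (neq_put _ _)) (IH _ _ _ ij1 (neq_put' _ _ _)) !mulr0 addr0 mulr0.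
rewrite (linear_sum_fun _ _ (rep_linear lP _)) inner_suml big1 // => c _.
have [_ _ _ ->] := lw (word _ j.+1 bs).
by rewrite innerZl (IH _ _ _ ij1 (neq_put _ _)) mulr0.
Qed.

(** Generators act in increasing order of their indices. If [s j] exchanges two
    different letters, then slot [j] has acquired a wrong letter that no later
    generator can repair; so only the diagonal entries of [R] contribute. *)
Lemma word_diag S bs j a :
  inner (l (word _ j bs) (itens (comb e a a (truncated S (j.+1 + size bs)) j.+1))) Xi
  = (\prod_(i < j.+1) Num.sqrt (p (a i)) * chain p (Rdiag q) S bs (a j))%:C.
Proof.
elim: bs j a => [|c bs IH] j a.
  rewrite (rep_one lP) addn0 inner_comb_vacuum mulr1 rmorph_prod /=.
  by apply: eq_bigr => i _; rewrite eqxx mul1r.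
rewrite word_cons_vector expand_truncated /= ?addnS ?ltnS ?leq_addr // -addSn.
have lw x := linear_unpack (rep_linear lP x).
have step x : (Num.sqrt (p x))%:C *
    (\prod_(i < j.+2) Num.sqrt (p (put a j.+1 x i))
       * chain p (Rdiag q) S bs (put a j.+1 x j.+1))%:C
  = (\prod_(i < j.+1) Num.sqrt (p (a i)) * (p x * chain p (Rdiag q) S bs x))%:C.
  rewrite -rmorphM /= big_ord_recr /= {2 3}/put eqxx.
  congr (_%:C); have -> : \prod_(i < j.+1) Num.sqrt (p (put a j.+1 x i))
     = \prod_(i < j.+1) Num.sqrt (p (a i)).
    by apply: eq_bigr => i _; rewrite /put ltn_eqF.
  by rewrite -{3}(sqr_sqrtr (p_ge0 x)); ring.
rewrite mulr_sumr rmorph_sum /=.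
case: c => /=.
  rewrite (linear_sum_fun _ _ (rep_linear lP _)) (linear_sum_fun _ _ (rep_linear lP _)).
  rewrite inner_suml; apply: eq_bigr => x _.
  have [_ _ _ ->] := lw (sigma j); have [_ wD _ wZ] := lw (word _ j.+1 bs).
  rewrite l_sigma_comb // wZ wD !wZ innerZl innerDl !innerZl.
  rewrite [X in _ * (_ + X)](_ : _ = 0) ?addr0; last first.
    have aj : put a j.+1 x j = a j by rewrite /put ltn_eqF.
    have aj1 : put a j.+1 x j.+1 = x by rewrite /put eqxx.
    rewrite aj aj1; case: (eqVneq (a j) x) => [ax|ax].
      by rewrite /Roff ax eqxx mul0r.
    rewrite (@word_offdiag _ _ _ j) ?mulr0 // aj.
    by rewrite {1}/put ltn_eqF // /put eqxx eq_sym.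
  rewrite IH mulrCA step -rmorphM /= {1}/put ltn_eqF // /put eqxx.
  by congr (_%:C); ring.
rewrite (linear_sum_fun _ _ (rep_linear lP _)) inner_suml; apply: eq_bigr => x _.
have [_ _ _ ->] := lw (word _ j.+1 bs).
by rewrite innerZl IH step mul1r.
Qed.

Lemma word_coefficient S bs :
  inner (l (word _ 0 bs) (itens (truncated S (size bs).+1))) Xi
  = (chains p (Rdiag q) S bs)%:C.
Proof.
pose a0 (n : nat) := zpos 0.
have -> : truncated S (size bs).+1 = comb e a0 a0 (truncated S (size bs).+1) 0.
  exact/funext.
rewrite expand_truncated // (linear_sum_fun _ _ (rep_linear lP _)) inner_suml.
rewrite rmorph_sum /=; apply: eq_bigr => c _.
have [_ _ _ ->] := linear_unpack (rep_linear lP (word _ 0 bs)).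
rewrite innerZl -(add1n (size bs)) word_diag big_ord1 /put eqxx -rmorphM /=.
by rewrite mulrA -expr2 sqr_sqrtr.
Qed.

Variable S : nat -> seq znz.
Hypothesis S_cvg : diag_vector (S n) @[n --> \oo] --> xi.

(** The slots are replaced one at a time. *)
Lemma truncated_cvg K : itens (truncated (S n) K) @[n --> \oo] --> Xi.
Proof.
elim: K => [|K IH].
  have e0 n : truncated (S n) 0 = fun=> xi by [].
  by under eq_fun do rewrite e0; exact: cvg_cst.
apply/cvgrPdist_lt => d d0.
have n0 : 0 < `|Xi| + 1 by rewrite ltr_wpDl.
have d2 : 0 < d / 2 by rewrite divr_gt0.
near=> n; have lt1 : `|Xi - itens (truncated (S n) K)| < d / 2.
  by near: n; move/cvgrPdist_lt: IH; apply.
have lt2 : `|Xi - itens (truncated (S n) K)| < 1.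
  by near: n; move/cvgrPdist_lt: IH; apply.
have lt3 : `|xi - diag_vector (S n)| < d / 2 / (`|Xi| + 1).
  by near: n; move/cvgrPdist_lt: S_cvg; apply; rewrite divr_gt0.
have ev := eventually_truncated (S n) K.
have e1 : truncated (S n) K.+1 = put (truncated (S n) K) K (diag_vector (S n)).
  by apply/funext => i; rewrite /put /truncated ltnS; case: ltngtP.
have e2 : truncated (S n) K = put (truncated (S n) K) K xi.
  by apply/funext => i; rewrite /put /truncated; case: ltngtP.
have [_ _ sB _] := linear_unpack (slot_linear itensP K ev).
rewrite -(subrKA (itens (truncated (S n) K))) (splitr d).
apply: le_lt_trans (ler_normD _ _) _; apply: ltrD => //.
rewrite e1 [in X in X - _]e2 -sB (slot_norm itensP) // -e2.
apply: le_lt_trans (_ : (`|Xi| + 1) * `|xi - diag_vector (S n)| < _).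
  rewrite ler_wpM2r // -(subKr Xi (itens _)) ; apply: le_trans (ler_normB _ _) _.
  by rewrite lerD2l ltW.
by rewrite -ltr_pdivlMl // mulrC.
Unshelve. all: by end_near.
Qed.

Lemma word_limit bs : let z := inner (l (word _ 0 bs) Xi) Xi in
  z = (complex.Re z)%:C
  /\ chains p (Rdiag q) (S n) bs @[n --> \oo] --> complex.Re z.
Proof.
apply: rmorph_limit => d d0; set y := l (hstar (word _ 0 bs)) Xi.
have hy x : inner (l (word _ 0 bs) x) Xi = inner x y.
  by rewrite innerC -(l_star lP lsym) -innerC.
have y0 : 0 < `|y| + 1 by rewrite ltr_wpDl.
near=> n; rewrite -word_coefficient !hy -innerBl.
apply: le_lt_trans (cauchy_schwarz _ _) _.
apply: le_lt_trans (_ : `|Xi - itens (truncated (S n) (size bs).+1)| * (`|y| + 1) < _).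
  by rewrite ler_wpM2l // lerDl.
rewrite -ltr_pdivlMr //; near: n.
by move/cvgrPdist_lt: (truncated_cvg (size bs).+1); apply; rewrite divr_gt0.
Unshelve. all: by end_near.
Qed.

End MatrixCoefficients.

(** * The vacuum vector *)

Section VacuumVector.
Variables (R : realType) (alpha beta : nat -> R).
Hypotheses (alpha_ge0 : forall i, 0 <= alpha i) (beta_ge0 : forall i, 0 <= beta i).
Hypothesis sum1 :
  (\sum_(0 <= i <oo) (alpha i)%:E + \sum_(0 <= j <oo) (beta j)%:E = 1)%E.

Lemma series_bounded_cvg (a : nat -> R) : (forall i, 0 <= a i) ->
  (\sum_(0 <= i <oo) (a i)%:E <= 1)%E ->
  [/\ cvgn (series a),
     (\sum_(0 <= i <oo) (a i)%:E = (limn (series a))%:E)%E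
    & forall k, (0 < k)%N -> cvgn (series (fun i => a i ^+ k))].
Proof.
move=> a0 le1.
have le n : series a n <= 1.
  rewrite -lee_fin; apply: le_trans le1; rewrite /series /= -sumEFin.
  by apply: nneseries_lim_ge => i _ _; rewrite lee_fin.
have ca : cvgn (series a).
  apply: nondecreasing_is_cvgn; first by apply: nondecreasing_series => i _ _.
  by exists 1 => _ [n _ <-].
split=> //.
  rewrite -EFin_lim //; congr (limn _); apply/funext => n.
  by rewrite /= sumEFin.
move=> k k0; apply: (series_le_cvg _ _ _ ca) => [i|//|i]; first exact: exprn_ge0.
have ai1 : a i <= 1.
  apply: le_trans (le i.+1); rewrite /series /= big_nat_recr //= lerDr.
  by rewrite sumr_ge0.
by case: k k0 => // k _; rewrite exprS ler_piMr // exprn_ile1.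
Qed.

Lemma parameters_cvg :
  [/\ psum alpha beta 1 = 1,
      forall k, (0 < k)%N -> cvgn (series (fun i => alpha i ^+ k))
    & forall k, (0 < k)%N -> cvgn (series (fun i => beta i ^+ k))].
Proof.
have ge0 (a : nat -> R) : (forall i, 0 <= a i) -> (0 <= \sum_(0 <= i <oo) (a i)%:E)%E.
  by move=> a0; apply: nneseries_ge0 => i _ _; rewrite lee_fin.
have [|_ ea ca] := series_bounded_cvg alpha_ge0.
  by rewrite -sum1 leeDl // ge0.
have [|_ eb cb] := series_bounded_cvg beta_ge0.
  by rewrite -sum1 leeDr // ge0.
split=> //; move: sum1; rewrite ea eb -EFinD => -[].
rewrite /psum sqrrN expr1n mul1r => <-.
by congr (limn _ + limn _); apply/funext => n; apply: eq_bigr => i _; rewrite expr1.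
Qed.

Lemma weight_ge0 a : 0 <= weight alpha beta a.
Proof. by rewrite /weight; case: (val a). Qed.

Variables (V W U : hilbertType R) (v : znz -> V) (w : znz -> W).
Hypotheses (vP : orthonormal_basis v) (wP : orthonormal_basis w).
Variable tens : {bilinear V -> W -> U}.
Hypothesis tensP : is_hilbert_tensor tens.
Let e a b := tens (v a) (w b).

Lemma tensor_basis_orthonormal : orthonormal2 e.
Proof. by move=> a b a' b'; rewrite /e tensP.1 vP.1 wP.1. Qed.

Lemma tensor_norm x y : `|tens x y| = `|x| * `|y|.
Proof.
by apply/eqP; rewrite -(@eqrXn2 _ 2) ?mulr_ge0 // exprMn -!inner_norm tensP.1.
Qed.

Lemma tensor_basis_total : total_set [set e p.1 p.2 | p in [set: znz * znz]].
Proof.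
apply: (total_trans tensP.2) => _ [[x y] _ <-] /=.
set A := [set e p.1 p.2 | p in _].
have cl := closed_lspan_subspace A.
move: x; apply: (total_ind vP.2).
  apply: (closed_subspace_preimage (C := `|y|)) => //.
  - by move=> c x x'; rewrite linearPl.
  - by move=> x; rewrite tensor_norm mulrC.
move=> _ [a _ <-] /=; move: y; apply: (total_ind wP.2).
  apply: (closed_subspace_preimage (C := `|v a|)) => //.
  - by move=> c y y'; rewrite linearPr.
  - by move=> y; rewrite tensor_norm.
by move=> _ [b _ <-] /=; apply: closed_lspan_ge; exists (a, b).
Qed.

Let xi := xi_vector v w tens alpha beta.

Lemma xi_limit : diag_vector e (weight alpha beta) (indices n) @[n --> \oo] --> xi.
Proof.
have [_ ca cb] := parameters_cvg.
have orth (z : nat -> znz) : injective z ->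
    forall i j, inner (e (z i) (z i)) (e (z j) (z j)) = (i == j)%:R.
  by move=> zI i j; rewrite tensor_basis_orthonormal (inj_eq zI) mulr_natl mulrb; case: eqP.
have cvg1 (a : nat -> R) : (forall k, (0 < k)%N -> cvgn (series (fun i => a i ^+ k))) ->
    cvgn (series a).
  by move=> /(_ 1%N isT); under eq_fun do rewrite expr1.
have cN : cvgn (series (fun j => (Num.sqrt (beta j))%:C *: e (zneg j) (zneg j))).
  apply: (cvg_orthonormal_series (orth _ _)) => //; last exact: cvg1.
  by move=> i j /(congr1 val) [].
have cP : cvgn (series (fun j => (Num.sqrt (alpha j))%:C *: e (zpos j) (zpos j))).
  apply: (cvg_orthonormal_series (orth _ _)) => //; last exact: cvg1.
  by move=> i j /(congr1 val) [].
apply: cvg_trans (cvgD cN cP); apply: near_eq_cvg; near=> n.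
rewrite /diag_vector big_indices -[LHS]/(series _ n + series _ n).
by congr (_ + _); rewrite /series /= big_mkord.
Unshelve. all: by end_near.
Qed.

Lemma mem_indices a n : (`|val a| <= n)%N -> a \in indices n.
Proof.
case: a => -[k|k] a0 /= kn; rewrite mem_cat; apply/orP; [right|left].
  case: k a0 kn => // k a0 kn; apply/mapP; exists k; rewrite ?mem_iota //.
  exact: val_inj.
apply/mapP; exists k; last exact: val_inj.
by rewrite mem_rev mem_iota /= add0n; exact: kn.
Qed.

Lemma xi_coefficient a b :
  inner xi (e a b) = (a == b)%:R * (Num.sqrt (weight alpha beta a))%:C.
Proof.
apply: (inner_lim xi_limit); near=> n; rewrite /diag_vector inner_suml.
have an : a \in indices n.
  by apply: mem_indices; near: n; exists `|val a|%N.
have un : uniq (indices n).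
  by apply: (pairwise_uniq _ (pairwise_indices n)) => c; rewrite ltxx.
rewrite (big_rem a) //= big_seq big1 => [|c].
  by rewrite addr0 innerZl tensor_basis_orthonormal eqxx mul1r mulrC.
rewrite mem_rem_uniq // inE => /andP[/negPf ca _].
by rewrite innerZl tensor_basis_orthonormal ca mul0r mulr0.
Unshelve. all: by end_near.
Qed.

End VacuumVector.

(** * Vacuum expectation, trace and equivalence *)

Theorem theorem1p5 (R : realType) (q : R) (alpha beta : nat -> R)
  (q_gt0 : 0 < q)
  (alpha_ge0 : forall i, 0 <= alpha i) (beta_ge0 : forall i, 0 <= beta i)
  (alpha_dec : forall i, alpha i.+1 <= alpha i)
  (beta_dec : forall i, beta i.+1 <= beta i)
  (sum1 : (\sum_(0 <= i <oo) (alpha i)%:E + \sum_(0 <= j <oo) (beta j)%:E = 1)%E)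
  (chi : {scalar hecke q}) (chiP : is_vk_trace alpha beta chi)
  (V W U X : hilbertType R)
  (v : znz -> V) (vP : orthonormal_basis v)
  (w : znz -> W) (wP : orthonormal_basis w)
  (tens : {bilinear V -> W -> U}) (tensP : is_hilbert_tensor tens)
  (xi : U) (xiE : xi = xi_vector v w tens alpha beta)
  (itens : (nat -> U) -> X) (itensP : is_infinite_tensor xi itens)
  (Xi : X) (XiE : Xi = itens (fun=> xi))
  (l r : hecke q -> X -> X)
  (lP : is_hilbert_rep l)
  (l_sigma : forall j, acts_as_Rleft q v tens xi itens j (l (sigma j)))
  (rP : is_hilbert_rep r)
  (r_sigma : forall j, acts_as_Rright q w tens xi itens j (r (sigma j)))
  (K : hilbertType R) (iota : {linear hecke q -> K}) (iotaP : is_gns_space chi iota)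
  (tau : hecke q -> hecke q -> K -> K) (tauP : is_tau iota tau) :
  (forall A : hecke q, inner (l A Xi) Xi = chi A)
  /\ equivalent_on
       (closed_lspan [set l p.1 (r p.2 Xi) | p in [set: hecke q * hecke q]])
       (fun A B x => l A (r B x)) tau.
Proof.
pose e a b := tens (v a) (w b).
have oe : orthonormal2 e by exact: tensor_basis_orthonormal.
have te : total_set [set e p.1 p.2 | p in [set: znz * znz]].
  exact: tensor_basis_total.
have la j : acts q xi itens e j (l (sigma j)).
  by move=> u ev a b c d; apply: l_sigma.
have ra j : acts q xi itens (fun b a => e a b) j (r (sigma j)).
  by move=> u ev b a d c; apply: r_sigma.
have llin A := rep_linear lP A; have rlin A := rep_linear rP A.
have lcont A := rep_bounded lP (a := A); have rcont A := rep_bounded rP (a := A).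
have oe' := flip_orthonormal oe; have te' := flip_total te.
have lsym j := acts_selfadjoint itensP oe te (llin _) (lcont _) (la j).
have rsym j := acts_selfadjoint itensP oe' te' (rlin _) (rcont _) (ra j).
have lr i j := acts_commute itensP te (llin _) (lcont _) (la i) (rlin _) (rcont _) (ra j).
have xi_e a b : inner xi (e a b)
    = (a == b)%:R * (Num.sqrt (weight alpha beta a))%:C.
  by rewrite xiE; apply: xi_coefficient.
have vac j : r (sigma j) Xi = l (sigma j) Xi.
  rewrite XiE; symmetry.
  exact: (acts_vacuum itensP oe te xi_e (llin _) (lcont _) (la j) (rlin _) (rcont _) (ra j)).
have tracial := vacuum_tracial lP rP lsym rsym lr vac.
have [p1 ca cb] := parameters_cvg alpha_ge0 beta_ge0 sum1.
have xi_lim : diag_vector e (weight alpha beta) (indices n) @[n --> \oo] --> xi.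
  by rewrite xiE; apply: xi_limit.
have lim bs := word_limit itensP (weight_ge0 alpha_ge0 beta_ge0) xi_e lP la lsym xi_lim bs.
rewrite -XiE /= in lim.
pose phi A := inner (l A Xi) Xi.
have phi_lin : scalar phi.
  by move=> c A B; rewrite /phi (rep_linear_l lP) innerDl innerZl.
(* [F m] is the vacuum expectation of a cycle of length [m]. *)
pose F m := if m is m'.+1 then complex.Re (phi (word _ 0 (nseq m' true))) else 0.
have F_newton : newton_at alpha beta q F.
  apply: newton_at_limit => // -[|m]; first exact: cvg_cst.
  exact: (lim _).2.
have phi_zeta m : (0 < m)%N -> phi (zeta q 0 m.-1) = (zeta_value alpha beta m q)%:C.
  move=> m0; rewrite -(zeta_value_newton p1 m0 F_newton) -{1}[m.-1]add0n zeta_word.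
  by rewrite /phi (lim _).1; case: m m0.
have phi_block c : phi (word _ 0 (block_mask c)) = \prod_(k <- c) phi (zeta q 0 k).
  have -> : \prod_(k <- c) phi (zeta q 0 k) = (\prod_(k <- c) F k.+1)%:C.
    rewrite rmorph_prod; apply: eq_bigr => k _.
    by rewrite -{1}[k]add0n zeta_word /phi (lim _).1.
  rewrite /phi (lim _).1; congr (_%:C).
  apply: (cvg_unique _ (lim _).2) => //=.
  under eq_fun do rewrite chains_block_mask.
  rewrite -[\prod_(k <- c) _]mulr1; apply: cvgM.
    by apply: cvg_bigprod => k; exact: (lim _).2.
  suff -> : 1 = complex.Re (inner (l (word _ 0 [::]) Xi) Xi) by exact: (lim _).2.
  by rewrite (rep_one lP) XiE (itens_inner itensP (N := 0)) ?big_ord0.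
have phiE A : phi A = chi A.
  have d_lin : scalar (fun A => phi A - chi A).
    by move=> c B B'; rewrite phi_lin linearP /= mulrBr opprD addrACA.
  pose d : {scalar hecke q} := HB.pack (fun A => phi A - chi A)
    (GRing.isLinear.Build _ _ _ _ (fun A => phi A - chi A) d_lin).
  have q0 : q%:C != 0 by rewrite gt_eqF // ltcR.
  apply/eqP; rewrite -subr_eq0; apply/eqP.
  apply: (trace_determined_sorted (d := d) q0) => [B B'|c sc].
    by rewrite /d /= (trace_comm (vk_trace chiP)) /phi tracial.
  rewrite /d /= phi_block -zeta_part_word (vk_zeta_part chiP); last first.
    rewrite /is_partition; apply/andP; split; last by apply/mapP => -[].
    by rewrite sorted_map.
  rewrite big_map; apply/eqP; rewrite subr_eq0; apply/eqP; apply: eq_bigr => k _.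
  by rewrite (vk_zeta chiP) // -phi_zeta.
split; first exact: phiE.
have [gns dense] := iotaP.
have rvac B : r B Xi = l (htransp B) Xi by exact: (r_vacuum lP rP lr vac).
have lrc A B x : l A (r B x) = r B (l A x) by exact: (lr_commute lP rP lr).
have iso A B : inner (l A Xi) (l B Xi) = inner (iota A) (iota B).
  by rewrite gns -phiE /phi (rep_mul lP) (l_star lP lsym).
have [T [TT Tiota]] := isometric_extension (rep_linear_alg Xi lP) dense iso.
have total_iota : total_set (range iota).
  apply/seteqP; split=> // x _; apply/closure_eps => d d0.
  have /closure_eps/(_ d d0)[y iy xy] : closure (range iota) x by rewrite dense.
  exists y => //; exists 1%N, (fun=> 1), (fun=> y).
  by rewrite big_ord1 scale1r.
have normT x : `|T x| = `|x|.
  by apply/eqP; rewrite -(@eqrXn2 _ 2) // -!inner_norm TT.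
have contT : continuous T.
  move=> x; apply/cvgrPdist_lt => d d0; near=> y.
  by rewrite -linearB normT; near: y; apply: cvgr_dist_lt.
exists T; split=> //.
- set S := [set l p.1 (r p.2 Xi) | p in _]; apply/seteqP; split.
    have cS : closed_subspace [set x | closed_lspan S (T x)].
      apply: (closed_subspace_preimage (C := 1)) => //; first exact: linearP.
        by move=> x; rewrite normT mul1r.
      exact: closed_lspan_subspace.
    suff TS x : closed_lspan S (T x) by move=> _ [x _ <-].
    apply: (total_ind total_iota cS) => _ [A _ <-] /=.
    apply: closed_lspan_ge; exists (A, 1) => //=.
    by rewrite (rep_one rP) Tiota.
  apply: closed_lspan_sub; first exact: isometry_range_subspace TT.
  move=> _ [[A B] _ <-] /=; exists (iota (A * htransp B)) => //.
  by rewrite Tiota rvac (rep_mul lP).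
- move=> A B; apply: (total_linear_ext total_iota).
  + by move=> c x y; rewrite (tau_linear tauP) linearP.
  + by move=> c x y; rewrite linearP rlin llin.
  + move=> x; apply: (@continuous_comp _ _ _ (tau A B) T); last exact: contT.
    exact: (tau_bounded tauP).
  + move=> x; apply: (@continuous_comp _ _ _ T (l A \o r B)); first exact: contT.
    by apply: continuous_comp; [exact: rcont|exact: lcont].
  move=> _ [Z _ <-]; rewrite (tau_iota tauP) !Tiota -lrc rvac.
  by rewrite !(rep_mul lP).
Unshelve. all: by end_near.
Qed.
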